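(* Let $f : [1,\infty) \to [1,\infty)$ be a function. Then $f$, applied entrywise, maps every Lorentz--Gram matrix to a Lorentz--Gram matrix (that is, $f[M] := [f(m_{ij})]$ is a Lorentz--Gram matrix whenever $M = [m_{ij}]$ is a Lorentz--Gram matrix of any size) if and only if $f$ has the representation \[ f(t) = 1 + \gamma\, 1_{(1,\infty)}(t) + \beta\, \frac{t^\alpha - 1}{\alpha} + \int_{(0,\infty)} (1 - t^{-s})\, \mathrm{d}\nu(s) \qquad (t \ge 1), \] where $\frac{t^\alpha - 1}{\alpha}$ is read as $\log t$ if $\alpha = 0$, for some $\alpha \in [0,1]$, $\beta \in [0,\infty)$, $\gamma \in [0,\infty)$ and some positive Radon measure $\nu$ on $(0,\infty)$ such that \[ \beta \ge \alpha\bigl(1 + \gamma + \nu((0,\infty))\bigr) \quad \text{if } \alpha \in (0,1] \] (so that $\nu$ is necessarily finite in this case), and \[ \int_{(0,\infty)} \min\{s, 1\}\, \mathrm{d}\nu(s) < \infty \quad \text{if } \alpha = 0. \]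
   Context: A Lorentz--Gram matrix is a real symmetric $n \times n$ matrix ($n \ge 1$ arbitrary) with all entries in $[1,\infty)$, all diagonal entries equal to $1$, and exactly one positive eigenvalue, counted with multiplicity. $1_{(1,\infty)}$ denotes the indicator function of $(1,\infty)$. *)

(* Defs.v *)
From HB Require Import structures.
From mathcomp Require Import all_boot all_order all_algebra.
From mathcomp Require Import all_classical all_reals all_analysis.

Set Implicit Arguments.
Unset Strict Implicit.
Unset Printing Implicit Defensive.

Import Order.TTheory GRing.Theory Num.Theory.
Import numFieldNormedType.Exports.

Local Open Scope classical_set_scope.
Local Open Scope ring_scope.

(* Multiplicities are algebraic: [mup a (char_poly M)] is the multiplicity of
   [a] as a root of the characteristic polynomial of [M]. *)
Definition one_positive_eigenvalue (R : realType) (n : nat) (M : 'M[R]_n) :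
    Prop :=
  exists a : R, [/\ 0 < a, eigenvalue M a, mup a (char_poly M) = 1%N
    & forall b : R, 0 < b -> eigenvalue M b -> b = a].

Definition Lorentz_Gram (R : realType) (n : nat) (M : 'M[R]_n) : Prop :=
  [/\ (0 < n)%N, M^T = M, forall i j, 1 <= M i j, forall i, M i i = 1
    & one_positive_eigenvalue M].

(* A Borel measure on the open set [D] of the real line is encoded as a Borel
   measure on the whole line that vanishes off [D].  It is Radon if it is
   finite on the compact subsets of [D] and inner regular with respect to
   them on all Borel subsets of [D]. *)
Definition Radon_on (R : realType) (D : set R)
    (nu : {measure set (measurableTypeR R) -> \bar R}) : Prop :=
  [/\ nu (~` D) = 0%E,
      forall K : set R, compact K -> K `<=` D -> (nu K < +oo)%E
    & forall B : set (measurableTypeR R), measurable B -> B `<=` D ->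
        nu B = ereal_sup [set nu K | K in [set K : set R | compact K /\ K `<=` B]]].

(* (t^alpha - 1) / alpha, extended by continuity to alpha = 0. *)
Definition box_cox (R : realType) (alpha t : R) : R :=
  if alpha == 0 then ln t else (t `^ alpha - 1) / alpha.

(* Main.v *)
(** A symmetric matrix [M] with entries at least [1] and diagonal [1] is a Lorentz-Gram matrix iff the
    kernel [M i0 i * M i0 j - M i j] is positive semidefinite.

    Sufficiency.  Write [M i j = b i * b j * (1 - k i j)] with [k] positive semidefinite and
    [`|k| < 1].  The power series of [(1 - x)^-s], [- ln (1 - x)] and [1 - (1 - x)^alpha] have
    nonnegative coefficients (the kernels themselves are reached from the geometric series by
    differentiating along [u * k]), so by Schur's product theorem [f[M]] is negative semidefinite on the
    hyperplane orthogonal to [b^alpha].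

    Necessity.  Repeating the points of a configuration frees the diagonal, so that the
    hypothesis applies to every kernel [m = b b^T - P] with entries at least [1] and [P] positive
    semidefinite.  On two points this says that [F x = f (e^x)] is nondecreasing and log-concave;
    hence [f (lam * t) / f t] tends to [lam^alpha] for some [alpha], and concavity of [f] gives
    [alpha <= 1].  Sending a base point to infinity shows that [f[m]] is negative semidefinite on the
    hyperplane orthogonal to [b^alpha].  If [alpha > 0], then [C e^(alpha x) - F x] is a bounded
    positive semidefinite Hankel function, where [C = lim e^(- alpha x) F x]; if [alpha = 0], so is
    [F (x + 1) - F x].  A bounded positive semidefinite Hankel function [H] is completely monotone,
    and Bernstein's theorem writes it as [H x = H 0 * \int_0^1 q(v)^x dv] with a monotone quantile
    function [q].  The image of Lebesgue measure under [- ln q] is [nu], and the set where [q]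
    vanishes accounts for the jump [gamma].  For [alpha = 0] this is applied to all the functions
    [F (n + 1 + x) - F (n + x)], whose sum over [n] telescopes. *)

Require Import Defs.
From HB Require Import structures.
From mathcomp Require Import all_boot all_order all_algebra.
From mathcomp Require Import all_classical all_reals all_analysis.
From mathcomp Require Import measurable_realfun complex ring lra.

Set Implicit Arguments.
Unset Strict Implicit.
Unset Printing Implicit Defensive.

Import Order.TTheory GRing.Theory Num.Theory.
Import numFieldNormedType.Exports.

Local Open Scope classical_set_scope.
Local Open Scope ring_scope.

(** * Quadratic forms and the spectral theorem *)

Definition qform (R : realType) (T : finType) (K : T -> T -> R) (c : T -> R) : R :=
  \sum_i \sum_j c i * c j * K i j.

(** Only the quadratic form is constrained; symmetry of the kernel is a separate hypothesis where it
    is used. *)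
Definition psd (R : realType) (T : finType) (K : T -> T -> R) : Prop :=
  forall c, 0 <= qform K c.

Section Spectral.
Local Open Scope sesquilinear_scope.
Variables (R : realType) (n : nat).
Implicit Type M : 'M[R]_n.
Local Notation C := R[i].
Local Notation toC := (real_complex R).


Lemma symmetric_hermsym M : M^T = M -> map_mx toC M \is hermsymmx.
Proof.
move=> sM; apply: realsym_hermsym.
  apply/is_hermitianmxP/matrixP => i j; rewrite expr0 !mxE /=.
  by rewrite -[in LHS]sM mxE mul1r.
by apply/mxOverP => i j; rewrite mxE complex_real.
Qed.

Lemma sym_spectral M : M^T = M ->
  exists (P : 'M[C]_n) (d : 'I_n -> R), P \is unitarymx /\
    map_mx toC M = P ^t* *m diag_mx (\row_k toC (d k)) *m P.
Proof.
move=> sM; have hM := symmetric_hermsym sM.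
have dr := hermitian_spectral_diag_real hM.
exists (spectralmx (map_mx toC M)), (fun k => complex.Re (spectral_diag (map_mx toC M) 0 k)).
split; first exact: spectral_unitarymx.
have /hermitian_normalmx /orthomx_spectralP e := hM.
rewrite {1}e invmx_unitary ?spectral_unitarymx //; congr (_ *m diag_mx _ *m _).
by apply/rowP => k; rewrite mxE; apply/esym/RRe_real; have /mxOverP := dr; apply.
Qed.


Lemma toC_conj (x : R) : (toC x)^* = toC x.
Proof. by apply/CrealP; rewrite complex_real. Qed.

(** The two mixed terms carry opposite factors ['i] and agree by symmetry of [M]. Complex vectors
    from the spectral theorem can thus be tested through their real and imaginary parts. *)
Lemma herm_split M (x y : 'cV[R]_n) : M^T = M ->
  let z := map_mx toC x + 'i *: map_mx toC y in
  (z ^t* *m map_mx toC M *m z) 0 0 =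
  toC ((x^T *m M *m x) 0 0 + (y^T *m M *m y) 0 0).
Proof.
move=> sM z.
have sxy : (x^T *m M *m y) 0 0 = (y^T *m M *m x) 0 0.
  have e : (x^T *m M *m y)^T = y^T *m M *m x by rewrite !trmx_mul trmxK sM mulmxA.
  by rewrite -e [RHS]mxE.
have -> : z ^t* = map_mx toC x^T - 'i *: map_mx toC y^T.
  apply/matrixP => i j; rewrite !mxE rmorphD rmorphM /= !toC_conj conjCi.
  by rewrite mulNr.
rewrite /z !mulmxBl mulmxDr mulmxDr.
rewrite -!scalemxAl -!scalemxAr -!map_mxM /= scalerA -expr2 sqrCi.
move: sxy; set a := _ *m x; set b := _ *m y; set c := _ *m x; set d := _ *m y.
clearbody a b c d; move=> sxy; rewrite !mxE sxy rmorphD /=; ring.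
Qed.

Lemma trmxC_mul m p q (A : 'M[C]_(m, p)) (B : 'M[C]_(p, q)) :
  (A *m B) ^t* = B ^t* *m A ^t*.
Proof. by rewrite trmx_mul map_mxM. Qed.

Lemma herm_diag (A P : 'M[C]_n) (d : 'I_n -> R) (z : 'cV[C]_n) :
  A = P ^t* *m diag_mx (\row_k toC (d k)) *m P ->
  (z ^t* *m A *m z) 0 0 = \sum_k toC (d k) * `|(P *m z) k 0| ^+ 2.
Proof.
move=> ->; rewrite !mulmxA -trmxC_mul -mulmxA mxE; apply: eq_bigr => k _.
rewrite normCK mul_mx_diag !mxE /=; ring.
Qed.

Lemma qformE M (c : 'I_n -> R) :
  qform M c = ((\col_i c i)^T *m M *m (\col_i c i : 'cV[R]_n)) 0 0.
Proof.
rewrite /qform mxE exchange_big; apply: eq_bigr => j _ /=.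
rewrite [X in X * _]mxE mulr_suml; apply: eq_bigr => i _ /=.
by rewrite !mxE; ring.
Qed.

Lemma char_poly_spectral M (P : 'M[C]_n) (d : 'I_n -> R) : P \is unitarymx ->
    map_mx toC M = P ^t* *m diag_mx (\row_k toC (d k)) *m P ->
  char_poly M = \prod_k ('X - (d k)%:P).
Proof.
move=> Pu e; apply: (map_poly_inj toC).
rewrite map_char_poly e; set D := diag_mx _.
have PP : P ^t* *m P = 1%:M by apply: mulmx1C; exact/unitarymxP.
have -> : char_poly (P ^t* *m D *m P) = char_poly D.
  have -> : char_poly (P ^t* *m D *m P) =
      \det (map_mx polyC (P ^t*) *m char_poly_mx D *m map_mx polyC P).
    congr (\det _); rewrite /char_poly_mx mulmxBr mulmxBl -!map_mxM; congr (_ - _).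
    by rewrite -scalemx1 -scalemxAr mulmx1 -scalemxAl -map_mxM PP map_scalar_mx.
  rewrite !det_mulmx mulrAC -det_mulmx -map_mxM PP map_scalar_mx /= det1 mul1r.
  by [].
rewrite char_poly_trig ?diag_mx_is_trig // rmorph_prod; apply: eq_bigr => k _.
by rewrite !mxE eqxx mulr1n rmorphB /= map_polyX map_polyC.
Qed.


Lemma qform_complex M (z : 'cV[C]_n) : M^T = M ->
  (z ^t* *m map_mx toC M *m z) 0 0 =
  toC (qform M (fun i => complex.Re (z i 0)) + qform M (fun i => complex.Im (z i 0))).
Proof.
move=> sM; have ez : z = map_mx toC (\col_i complex.Re (z i 0)) +
    'i *: map_mx toC (\col_i complex.Im (z i 0)).
  by apply/matrixP => i j; rewrite ord1 !mxE [LHS]complexE.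
by rewrite [in LHS]ez herm_split // !qformE.
Qed.

Lemma qform_spectral M (P : 'M[C]_n) (d : 'I_n -> R) (c : 'I_n -> R) : M^T = M ->
    map_mx toC M = P ^t* *m diag_mx (\row_k toC (d k)) *m P ->
  toC (qform M c) = \sum_k toC (d k) * `|(P *m map_mx toC (\col_i c i)) k 0| ^+ 2.
Proof.
move=> sM e; rewrite -(herm_diag _ e) qform_complex // rmorphD /=.
rewrite [X in _ + toC X](_ : _ = 0) ?addr0.
  by congr (toC (qform M _)); apply/funext => i; rewrite !mxE.
by rewrite /qform big1 // => i _; rewrite big1 // => j _; rewrite !mxE /= !mul0r.
Qed.

(** An eigenvector [v] for the positive eigenvalue is the normal [w]. In spectral coordinates it
    lives on the only index with positive [d], so a vector orthogonal to it meets nonpositive terms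
    only. *)
Lemma one_positive_hyperplane M : M^T = M -> one_positive_eigenvalue M ->
  exists w : 'I_n -> R, forall c, \sum_i c i * w i = 0 -> qform M c <= 0.
Proof.
move=> sM [a [a0 eva mupa ua]]; have [P [d [Pu e]]] := sym_spectral sM.
have cp := char_poly_spectral Pu e.
have [k0 k0P] : exists k0, forall k, 0 < d k -> k = k0.
  move: mupa; rewrite cp.
  have -> : \prod_k ('X - (d k)%:P) = \prod_(y <- map d (enum 'I_n)) ('X - y%:P).
    by rewrite big_map big_enum.
  rewrite mu_prod_XsubC count_map -size_filter => /eqP.
  case h : [seq x <- _ | _] => [|k0 [|k1 l]] // _.
    exists k0 => k dk; have : k \in [:: k0]; last by rewrite inE => /eqP.
  rewrite -h mem_filter mem_enum andbT /=; apply/eqP/ua => //.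
  by rewrite eigenvalue_root_char cp /root horner_prod (bigD1 k) //= !hornerE subrr mul0r.
have [v vM v0] := eigenvalueP eva.
exists (fun i => v 0 i) => c cw.
(* So far [k0] is only the sole candidate for a positive [d k]; if [d k0] is not positive, every
   term is already nonpositive. *)
have [dk0|dk0] := ltP 0 (d k0); last first.
  rewrite -lecR (qform_spectral c sM e); apply: sumr_le0 => k _.
  rewrite mulr_le0_ge0 ?exprn_ge0 // lecR leNgt; apply/negP => dk.
  by move: dk dk0; rewrite leNgt => dk; rewrite -(k0P _ dk) dk.
have da : d k0 = a.
  apply: ua => //.
  by rewrite eigenvalue_root_char cp /root horner_prod (bigD1 k0) //= !hornerE subrr mul0r.
pose V := P *m map_mx toC v^T; pose Z := P *m map_mx toC (\col_i c i).
have PP : P ^t* *m P = 1%:M by apply: mulmx1C; exact/unitarymxP.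
have PV k : k != k0 -> V k 0 = 0.
  move=> kk; have : diag_mx (\row_k toC (d k)) *m V = toC a *: V.
    have Mv : M *m v^T = a *: v^T by rewrite -[M in LHS]sM -trmx_mul vM linearZ.
    rewrite /V scalemxAr -map_mxZ -Mv map_mxM e !mulmxA.
    by have /unitarymxP -> := Pu; rewrite mul1mx.
  move=> /matrixP /(_ k 0); rewrite mul_diag_mx !mxE.
  move=> /eqP; rewrite -subr_eq0 -mulrBl mulf_eq0 => /orP[|/eqP//].
  rewrite subr_eq0 => /eqP /complexI dka; case/eqP: kk; apply: k0P.
  by rewrite dka.
have VZ : (V ^t* *m Z) 0 0 = 0.
  rewrite /V /Z trmxC_mul mulmxA -[_ *m _ *m P]mulmxA PP mulmx1.
  rewrite mxE -[RHS](rmorph0 toC) -cw rmorph_sum; apply: eq_bigr => i _.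
  by rewrite !mxE toC_conj rmorphM mulrC.
have Vk0 : V k0 0 != 0.
  apply: contra_neq v0 => Vk0; have V0 : V = 0.
    by apply/matrixP => k j; rewrite ord1 [RHS]mxE; have [->//|/PV] := eqVneq k k0.
  have : P ^t* *m V = 0 by rewrite V0 mulmx0.
  rewrite mulmxA PP mul1mx => /matrixP v0; apply/rowP => i.
  by have := v0 i 0; rewrite !mxE => /complexI.
have Zk0 : Z k0 0 = 0.
  have Vt k : (V ^t*) 0 k = (V k 0)^* by rewrite mxE mxE.
  move: VZ; rewrite mxE (bigD1 k0) //= big1 ?addr0.
    by rewrite Vt => /eqP; rewrite mulf_eq0 conjC_eq0 (negbTE Vk0) => /eqP.
  by move=> k /PV Vk; rewrite Vt Vk conjC0 mul0r.
rewrite -lecR (qform_spectral c sM e); apply: sumr_le0 => k _.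
have [->|kk] := eqVneq k k0; first by rewrite Zk0 normr0 expr0n mulr0.
rewrite mulr_le0_ge0 ?exprn_ge0 // lecR leNgt; apply: contra kk => dk.
by apply/eqP/k0P.
Qed.

(** Two positive eigenvalues would span a complex plane on which the form is positive. This plane
    meets the hyperplane in a nonzero vector, whose real and imaginary parts both lie in the real
    hyperplane. *)
Lemma hyperplane_one_positive M (w : 'I_n -> R) (x : 'I_n -> R) : M^T = M ->
    (forall c, \sum_i c i * w i = 0 -> qform M c <= 0) -> 0 < qform M x ->
  one_positive_eigenvalue M.
Proof.
move=> sM wM xM; have [P [d [Pu e]]] := sym_spectral sM.
have cp := char_poly_spectral Pu e.
have evd k : eigenvalue M (d k).
  by rewrite eigenvalue_root_char cp /root horner_prod (bigD1 k) //= !hornerE subrr mul0r.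
have [k0 dk0] : exists k0, 0 < d k0.
  apply: contrapT => /forallNP dk; move: xM; rewrite ltNge => /negP; apply.
  rewrite -lecR (qform_spectral x sM e); apply: sumr_le0 => k _.
  by rewrite mulr_le0_ge0 ?exprn_ge0 // lecR leNgt; apply/negP.
have PP : P *m P ^t* = 1%:M by exact/unitarymxP.
have k0u k1 : 0 < d k1 -> k1 = k0.
  move=> dk1; apply/eqP; apply/negPn/negP => k10.
  have [s [t [st0 stw]]] : exists s t : C, (s, t) != 0 /\
      \sum_i (P ^t* *m (s *: delta_mx k0 0 + t *: delta_mx k1 0) : 'cV[C]_n) i 0 * toC (w i) = 0.
    pose al k := \sum_i (P ^t* *m (delta_mx k 0 : 'cV[C]_n)) i 0 * toC (w i).
    have key s t : \sum_i (P ^t* *m (s *: delta_mx k0 0 + t *: delta_mx k1 0) : 'cV[C]_n) i 0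
        * toC (w i) = s * al k0 + t * al k1.
      rewrite mulmxDr -!scalemxAr !mulr_sumr -big_split; apply: eq_bigr => i _ /=.
      by rewrite 3!mxE [X in (_ + X) * _]mxE mulrDl !mulrA.
    have [a0|a0] := eqVneq (al k0) 0.
      by exists 1, 0; split; [rewrite xpair_eqE oner_eq0|rewrite key a0; ring].
    exists (al k1), (- al k0); split; last by rewrite key; ring.
    by rewrite xpair_eqE oppr_eq0 (negbTE a0) andbF.
  set z := _ *m _ in stw.
  have : qform M (fun i => complex.Re (z i 0)) + qform M (fun i => complex.Im (z i 0)) <= 0.
    apply: (@le_trans _ _ (0 + 0)); last by rewrite addr0.
    apply: lerD; apply: wM.
      transitivity (complex.Re (\sum_i z i 0 * toC (w i))); last by rewrite stw.
      rewrite raddf_sum; apply: eq_bigr => i _; case: (z i 0) => a b /=; ring.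
    transitivity (complex.Im (\sum_i z i 0 * toC (w i))); last by rewrite stw.
    rewrite raddf_sum; apply: eq_bigr => i _; case: (z i 0) => a b /=; ring.
  rewrite -lecR -qform_complex // (herm_diag _ e) /z mulmxA PP mul1mx.
  rewrite (bigD1 k0) //= (bigD1 k1) //= big1; last first.
    move=> k /andP[k0' k1']; rewrite !mxE (negbTE k0') (negbTE k1') /=.
    by rewrite !mulr0 addr0 normr0 expr0n mulr0.
  rewrite !mxE !eqxx (negbTE k10) eq_sym (negbTE k10) /= !(mulr0, mulr1, addr0, add0r).
  suff h : 0 < toC (d k0) * `|s| ^+ 2 + toC (d k1) * `|t| ^+ 2 by move=> /le_gtF; rewrite h.
  have dk0' : 0 < toC (d k0) by rewrite ltcR.
  have dk1' : 0 < toC (d k1) by rewrite ltcR.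
  move: st0; rewrite xpair_eqE negb_and => /orP[s0|t0].
    apply: ltr_pwDl; first by rewrite mulr_gt0 // exprn_gt0 // normr_gt0.
    by rewrite mulr_ge0 ?exprn_ge0 // ltW.
  apply: ltr_wpDl; last by rewrite mulr_gt0 // exprn_gt0 // normr_gt0.
  by rewrite mulr_ge0 ?exprn_ge0 // ltW.
exists (d k0); split => //; last first.
  move=> b b0; rewrite eigenvalue_root_char cp /root horner_prod prodf_seq_eq0.
  by case/hasP => k _ /=; rewrite !hornerE subr_eq0 => /eqP bd; rewrite bd (k0u k) // -bd.
rewrite cp.
have -> : \prod_k ('X - (d k)%:P) = \prod_(y <- map d (enum 'I_n)) ('X - y%:P).
  by rewrite big_map big_enum.
rewrite mu_prod_XsubC count_map -[RHS](_ : count_mem k0 (enum 'I_n) = _); last first.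
  by rewrite count_uniq_mem ?enum_uniq // mem_enum.
by apply: eq_count => k /=; apply/eqP/eqP => [dk|->//]; apply: k0u; rewrite dk.
Qed.

(** The diagonalizing unitary matrix may be complex: each row, scaled by [Num.sqrt (d k)], yields
    two real functions, its real and imaginary parts, selected by the boolean. *)
Lemma psd_gram_mx M : M^T = M -> psd M ->
  exists g : 'I_n * bool -> 'I_n -> R, forall i j, M i j = \sum_k g k i * g k j.
Proof.
move=> sM pM; have [P [d [Pu e]]] := sym_spectral sM.
have PP : P *m P ^t* = 1%:M by exact/unitarymxP.
have d0 k : 0 <= d k.
  pose z := P ^t* *m (delta_mx k 0 : 'cV[C]_n).
  have Pz : P *m z = delta_mx k 0 by rewrite mulmxA PP mul1mx.
  rewrite -lecR; have := herm_diag z e.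
  rewrite Pz qform_complex // (bigD1 k) //= big1 => [|j jk].
    by rewrite mxE !eqxx normr1 expr1n mulr1 addr0 => <-; rewrite lecR addr_ge0.
  by rewrite mxE (negbTE jk) normr0 expr0n mulr0.
exists (fun kb i => Num.sqrt (d kb.1) *
  if kb.2 then complex.Re (P kb.1 i) else complex.Im (P kb.1 i)) => i j.
have -> : M i j = complex.Re (map_mx toC M i j) by rewrite mxE.
rewrite e mxE raddf_sum -(pair_bigA _ (fun k b => (Num.sqrt (d k) *
  (if b then complex.Re (P k i) else complex.Im (P k i))) * (Num.sqrt (d k) *
  (if b then complex.Re (P k j) else complex.Im (P k j))))) /=.
apply: eq_bigr => k _; rewrite mul_mx_diag !mxE big_bool /=.
have -> : d k = Num.sqrt (d k) ^+ 2 by rewrite sqr_sqrtr.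
rewrite sqrtr_sqr ger0_norm ?sqrtr_ge0 //.
case: (P k i) (P k j) => a b [a' b'] /=; ring.
Qed.

End Spectral.

(** * Positive semidefinite kernels and Lorentz-Gram matrices *)

Lemma cvg_sumr (R : realType) (I U : Type) (r : seq I) (F : set_system U)
    (FF : Filter F) (f : I -> U -> R) (l : I -> R) :
  (forall i, f i u @[u --> F] --> l i) ->
  \sum_(i <- r) f i u @[u --> F] --> \sum_(i <- r) l i.
Proof.
move=> fl; elim: r => [|i r IHr].
  by rewrite big_nil; under eq_fun do rewrite big_nil; exact: cvg_cst.
by rewrite big_cons; under eq_fun do rewrite big_cons; exact: cvgD.
Qed.

Section Kernels.
Variables (R : realType) (T : finType).
Implicit Types (K L : T -> T -> R) (a c : T -> R).

Lemma eq_qform K L c : (forall i j, K i j = L i j) -> qform K c = qform L c.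
Proof. by move=> KL; do 2!(apply: eq_bigr => ? _); rewrite KL. Qed.

Lemma qformD K L c : qform (fun i j => K i j + L i j) c = qform K c + qform L c.
Proof.
rewrite /qform -big_split; apply: eq_bigr => i _ /=; rewrite -big_split /=.
by apply: eq_bigr => j _; rewrite mulrDr.
Qed.

Lemma qformZ (k : R) K c : qform (fun i j => k * K i j) c = k * qform K c.
Proof.
rewrite /qform mulr_sumr; apply: eq_bigr => i _; rewrite mulr_sumr.
by apply: eq_bigr => j _; ring.
Qed.

Lemma qformN K c : qform (fun i j => - K i j) c = - qform K c.
Proof. by rewrite -mulN1r -qformZ; apply: eq_qform => i j; rewrite mulN1r. Qed.

Lemma qformB K L c : qform (fun i j => K i j - L i j) c = qform K c - qform L c.
Proof. by rewrite qformD qformN. Qed.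

Lemma qform_rank1 a c : qform (fun i j => a i * a j) c = (\sum_i c i * a i) ^+ 2.
Proof.
rewrite expr2 /qform mulr_suml; apply: eq_bigr => i _; rewrite mulr_sumr.
by apply: eq_bigr => j _; ring.
Qed.

Lemma qform_cst (k : R) c : qform (fun _ _ => k) c = k * (\sum_i c i) ^+ 2.
Proof.
transitivity (k * qform (fun i j : T => (fun=> 1) i * (fun=> 1) j) c).
  by rewrite -qformZ; apply: eq_qform => i j; rewrite !mulr1.
by rewrite qform_rank1; congr (_ * _ ^+ 2); apply: eq_bigr => i _; rewrite mulr1.
Qed.

Lemma qform_diag a c :
  qform (fun i j => if i == j then a i else 0) c = \sum_i c i ^+ 2 * a i.
Proof.
apply: eq_bigr => i _; rewrite (bigD1 i) //= big1 ?eqxx ?addr0 ?expr2 //.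
by move=> j ji; rewrite eq_sym (negbTE ji) mulr0.
Qed.

Lemma qform_scale K c b :
  qform (fun i j => b i * b j * K i j) c = qform K (fun i => c i * b i).
Proof. by do 2!(apply: eq_bigr => ? _); ring. Qed.

Lemma eq_psd K L : (forall i j, K i j = L i j) -> psd K -> psd L.
Proof. by move=> KL pK c; rewrite -(eq_qform c KL). Qed.

Lemma psdD K L : psd K -> psd L -> psd (fun i j => K i j + L i j).
Proof. by move=> pK pL c; rewrite qformD addr_ge0. Qed.

Lemma psdZ (k : R) K : 0 <= k -> psd K -> psd (fun i j => k * K i j).
Proof. by move=> k0 pK c; rewrite qformZ mulr_ge0. Qed.

Lemma psd_rank1 a : psd (fun i j => a i * a j).
Proof. by move=> c; rewrite qform_rank1 sqr_ge0. Qed.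

Lemma psd_cst (k : R) : 0 <= k -> psd (fun _ _ : T => k).
Proof. by move=> k0 c; rewrite qform_cst mulr_ge0 ?sqr_ge0. Qed.

Lemma psd_diag a : (forall i, 0 <= a i) -> psd (fun i j => if i == j then a i else 0).
Proof. by move=> a0 c; rewrite qform_diag sumr_ge0 // => i _; rewrite mulr_ge0 ?sqr_ge0. Qed.

Lemma psd_scale K a : psd K -> psd (fun i j => a i * a j * K i j).
Proof. by move=> pK c; rewrite qform_scale. Qed.

Lemma cvg_qform (U : Type) (F : set_system U) (FF : Filter F) (K_ : U -> T -> T -> R) K c :
  (forall i j, K_ u i j @[u --> F] --> K i j) -> qform (K_ u) c @[u --> F] --> qform K c.
Proof.
move=> KK; apply: cvg_sumr => i; apply: cvg_sumr => j.
by apply: cvgM; [exact: cvg_cst|exact: KK].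
Qed.

Lemma psd_cvg (K_ : nat -> T -> T -> R) K : (forall n, psd (K_ n)) ->
  (forall i j, K_ n i j @[n --> \oo] --> K i j) -> psd K.
Proof.
move=> pK KK c; have h : qform (K_ n) c @[n --> \oo] --> qform K c by exact: cvg_qform.
by apply: (cvgr_to_ge h); apply: nearW => n; exact: pK.
Qed.

End Kernels.

(** Repeating points adds up the coefficients over each fibre of [h]. *)
Lemma qform_sub (R : realType) (T T' : finType) (h : T' -> T) (K : T -> T -> R) c :
  qform (fun i j => K (h i) (h j)) c = qform K (fun t => \sum_(i | h i == t) c i).
Proof.
rewrite /qform [LHS](partition_big h predT) //=; apply: eq_bigr => t _.
under [LHS]eq_bigr do rewrite (partition_big h predT) //=.
rewrite exchange_big; apply: eq_bigr => t' _ /=.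
rewrite mulr_suml mulr_suml; apply: eq_bigr => i /eqP <-.
by rewrite mulr_sumr mulr_suml; apply: eq_bigr => j /eqP <-.
Qed.

Lemma psd_sub (R : realType) (T T' : finType) (h : T' -> T) (K : T -> T -> R) :
  psd K -> psd (fun i j => K (h i) (h j)).
Proof. by move=> pK c; rewrite qform_sub. Qed.

Lemma psd_gram (R : realType) (T : finType) (K : T -> T -> R) :
    (forall i j, K i j = K j i) -> psd K ->
  exists (U : finType) (g : U -> T -> R), forall i j, K i j = \sum_k g k i * g k j.
Proof.
move=> sK pK; pose M : 'M[R]_#|T| := \matrix_(i, j) K (enum_val i) (enum_val j).
have [|c|g gE] := @psd_gram_mx R _ M.
- by apply/matrixP => i j; rewrite !mxE sK.
- by rewrite (eq_qform (L := fun i j => K (enum_val i) (enum_val j))) ?psd_sub // => i j; rewrite mxE.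
exists ('I_#|T| * bool)%type, (fun k t => g k (enum_rank t)) => i j.
by rewrite -gE mxE !enum_rankK.
Qed.

(** Schur's product theorem: a Gram decomposition of [K] turns the form of the product into a sum of
    forms of [L] with rescaled coefficients. *)
Lemma psdM (R : realType) (T : finType) (K L : T -> T -> R) :
    (forall i j, K i j = K j i) -> psd K -> psd L ->
  psd (fun i j => K i j * L i j).
Proof.
move=> sK pK pL c; have [U [g gE]] := psd_gram sK pK.
rewrite (_ : qform _ _ = \sum_k qform L (fun i => c i * g k i)) ?sumr_ge0 //.
rewrite /qform [RHS]exchange_big; apply: eq_bigr => i _ /=.
rewrite [RHS]exchange_big; apply: eq_bigr => j _ /=.
rewrite gE mulr_suml mulr_sumr; apply: eq_bigr => k _; ring.
Qed.

Lemma psdX (R : realType) (T : finType) (K : T -> T -> R) n :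
  (forall i j, K i j = K j i) -> psd K -> psd (fun i j => K i j ^+ n).
Proof.
move=> sK pK; elim: n => [|n IHn].
  by apply: (@eq_psd _ _ (fun _ _ => 1)) => [i j|]; [rewrite expr0|exact: psd_cst ler01].
by apply: eq_psd; last exact: psdM sK pK IHn; move=> i j; rewrite exprS.
Qed.

(** The kernel is minus the Schur complement of the entry [M i0 i0 = 1]. If its form were negative
    somewhere, [M] would be positive on a plane through the basis vector of [i0], which meets the
    hyperplane where [M] is nonpositive. *)
Lemma Lorentz_Gram_schur (R : realType) n (M : 'M[R]_n) i0 : Lorentz_Gram M ->
  psd (fun i j => M i0 i * M i0 j - M i j).
Proof.
case=> [_ sM _ dM opM] c; have [w wP] := one_positive_hyperplane sM opM.
have sM' i j : M i j = M j i by rewrite -[in LHS]sM mxE.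
pose e i := (i == i0)%:R : R.
pose t := \sum_i c i * M i0 i.
have eE F : \sum_i e i * F i = F i0.
  by rewrite (bigD1 i0) //= big1 ?addr0 /e ?eqxx ?mul1r // => i /negbTE->; rewrite mul0r.
rewrite qformB qform_rank1 -/t subr_ge0.
(* The component of [c] orthogonal to [e] for the bilinear form [B]. *)
pose y i := c i - t * e i.
pose B (x z : 'I_n -> R) := \sum_i \sum_j x i * z j * M i j.
have BC x z : B x z = B z x.
  by rewrite /B exchange_big; do 2!(apply: eq_bigr => ? _); rewrite sM' [_ * z _]mulrC.
have BL s r x z u : B (fun i => s * x i + r * z i) u = s * B x u + r * B z u.
  rewrite /B !mulr_sumr -big_split; apply: eq_bigr => i _ /=.
  by rewrite !mulr_sumr -big_split; apply: eq_bigr => j _ /=; ring.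
have Bec x : B e x = \sum_i x i * M i0 i.
  rewrite /B (bigD1 i0) //= [X in _ + X]big1 ?addr0 => [|i ii].
    by apply: eq_bigr => j _; rewrite /e eqxx mul1r.
  by rewrite big1 // => j _; rewrite /e (negbTE ii) !mul0r.
have Bee : B e e = 1 by rewrite Bec eE dM.
have Bey : B e y = 0.
  rewrite Bec /y; under eq_bigr do rewrite mulrBl -mulrA.
  by rewrite sumrB -mulr_sumr eE dM mulr1 subrr.
have Byy : B y y = qform M c - t ^+ 2.
  have cE : c = (fun i => 1 * y i + t * e i).
    by apply/funext => i; rewrite /y; ring.
  have -> : qform M c = B c c by [].
  rewrite [in RHS]cE BL [X in 1 * X]BC [X in t * X]BC !BL Bee Bey [B y e]BC Bey; ring.
rewrite -subr_le0 -Byy leNgt; apply/negP => y0.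
(* The combination of [e] and [y] in the hyperplane orthogonal to [w]. Its form is a sum of two
   nonnegative terms, so both vanish and [y] itself lies in the hyperplane. *)
pose z i := (\sum_j y j * w j) * e i + (- w i0) * y i.
have : qform M z <= 0.
  apply: wP; rewrite /z; under eq_bigr do rewrite mulrDl -!mulrA.
  by rewrite big_split -!mulr_sumr eE /=; ring.
have -> : qform M z = (\sum_j y j * w j) ^+ 2 + w i0 ^+ 2 * B y y.
  have -> : qform M z = B z z by [].
  rewrite /z BL [X in _ * X + _]BC [X in _ + _ * X]BC !BL Bee Bey [B y e]BC Bey; ring.
move=> z0; have w0 : w i0 ^+ 2 * B y y = 0.
  apply/eqP; rewrite eq_le; apply/andP; split; last by rewrite mulr_ge0 ?sqr_ge0 // ltW.
  by apply: le_trans z0; rewrite lerDr sqr_ge0.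
have yw : (\sum_j y j * w j) = 0.
  by apply/eqP; rewrite -sqrf_eq0 eq_le sqr_ge0 andbT; move: z0; rewrite w0 addr0.
by have := wP _ yw; rewrite leNgt => /negP; apply.
Qed.

Lemma Lorentz_Gram_hyperplane (R : realType) n (M : 'M[R]_n) (w : 'I_n -> R) (i0 : 'I_n) :
    (forall i j, M i j = M j i) -> (forall i j, 1 <= M i j) -> (forall i, M i i = 1) ->
    (forall c, \sum_i c i * w i = 0 -> qform M c <= 0) ->
  Lorentz_Gram M.
Proof.
move=> sM M1 dM wM; have sM' : M^T = M by apply/matrixP => i j; rewrite mxE sM.
split=> //; first by case: (i0) => k; case: (n).
apply: (@hyperplane_one_positive R n M w (fun i => (i == i0)%:R) sM' wM).
rewrite /qform (bigD1 i0) //= [X in _ + X]big1 ?addr0 => [|i /negbTE ii]; last first.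
  by rewrite big1 // => j _; rewrite ii !mul0r.
rewrite (bigD1 i0) //= big1 ?addr0 => [|i /negbTE ii]; last by rewrite ii mulr0 mul0r.
by rewrite eqxx dM !mul1r.
Qed.

Definition LG_preserver (R : realType) (f : R -> R) :=
  forall n (M : 'M[R]_n), Lorentz_Gram M -> Lorentz_Gram (map_mx f M).

Lemma LG_preserver_schur (R : realType) (f : R -> R) (T : finType) (m : T -> T -> R) (t0 : T) :
    LG_preserver f ->
    (forall i j, m i j = m j i) -> (forall i j, 1 <= m i j) -> (forall i, m i i = 1) ->
    psd (fun i j => m t0 i * m t0 j - m i j) ->
  psd (fun i j => f (m t0 i) * f (m t0 j) - f (m i j)).
Proof.
move=> pf sm m1 dm pm.
pose M : 'M[R]_#|T| := \matrix_(i, j) m (enum_val i) (enum_val j).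
have lM : Lorentz_Gram M.
  apply: (@Lorentz_Gram_hyperplane R _ M (fun i => m t0 (enum_val i)) (enum_rank t0)).
  - by move=> i j; rewrite !mxE.
  - by move=> i j; rewrite !mxE.
  - by move=> i; rewrite !mxE.
  move=> c cw; have := psd_sub (@enum_val T predT) pm c.
  rewrite qformB (qform_rank1 (fun i => m t0 (enum_val i))) cw expr0n sub0r oppr_ge0.
  by apply: le_trans; rewrite (eq_qform (L := M)) // => i j; rewrite mxE.
have := Lorentz_Gram_schur (enum_rank t0) (pf _ _ lM) => h.
apply: (eq_psd _ (psd_sub enum_rank h)) => i j.
by rewrite !mxE !enum_rankK.
Qed.

(** * Inequalities satisfied by a preserver *)

Lemma archi_le0 (R : realType) (x D : R) : (forall n : nat, x * n.+1%:R <= D) -> x <= 0.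
Proof.
move=> xD; rewrite leNgt; apply/negP => x0.
have := xD (Num.truncn (D / x)); rewrite leNgt => /negP; apply.
by rewrite mulrC -ltr_pdivrMr // truncnS_gt.
Qed.

Lemma big_option (R : realType) (T : finType) (F : option T -> R) :
  \sum_u F u = F None + \sum_i F (Some i).
Proof.
rewrite (bigD1 None) //=; congr (_ + _).
by rewrite (reindex_omap Some id) //= => [|[]//]; apply: eq_bigl => i; rewrite eqxx.
Qed.

Lemma qform_option (R : realType) (T : finType) (K : option T -> option T -> R) c :
  c None = 0 -> qform K c = qform (fun i j => K (Some i) (Some j)) (c \o Some).
Proof.
move=> c0; rewrite /qform big_option big1 ?add0r => [|u _]; last by rewrite c0 !mul0r.
by apply: eq_bigr => i _; rewrite big_option c0 mulr0 mul0r add0r.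
Qed.

Lemma psd_option (R : realType) (T : finType) (P : T -> T -> R) : psd P ->
  psd (fun u v : option T => if u is Some i then if v is Some j then P i j else 0 else 0).
Proof.
move=> pP c; rewrite [X in _ <= X](_ : _ = qform P (c \o Some)) //.
rewrite /qform big_option big1 ?add0r => [|u _]; last by rewrite mulr0.
by apply: eq_bigr => i _; rewrite big_option mulr0 add0r.
Qed.

Section Necessity.
Variables (R : realType) (f : R -> R).
Hypothesis hf : forall t, 1 <= t -> 1 <= f t.
Hypothesis pf : LG_preserver f.

(* Repeating each point [N] times turns the diagonal entries [1] of a Lorentz-Gram matrix into a
   perturbation of size [1 / N]: in the limit the diagonal of [m] may be arbitrary. *)
Lemma preserver_qform (T : finType) (b : T -> R) (m : T -> T -> R) (tau : R) c :
    1 <= tau -> (forall i, 1 <= tau * b i) ->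
    (forall i j, m i j = m j i) -> (forall i j, 1 <= m i j) ->
    psd (fun i j => b i * b j - m i j) ->
  qform (fun i j => f (m i j)) c <= (\sum_i c i * f (tau * b i)) ^+ 2.
Proof.
move=> tau1 taub sm m1 pm; rewrite -subr_le0.
apply: (@archi_le0 _ _ (\sum_i c i ^+ 2 * (f (m i i) - f 1))) => N.
pose U := (T * 'I_N.+1)%type.
(* The point [None] is the base of the Schur complement; the factor [tau] lifts its entries to at
   least [1]. *)
pose mm (u v : option U) : R := match u, v with
  | None, None => 1
  | None, Some p => tau * b p.1
  | Some p, None => tau * b p.1
  | Some p, Some q => if p == q then 1 else m p.1 q.1 end.
have : psd (fun u v => f (mm None u) * f (mm None v) - f (mm u v)).
  apply: LG_preserver_schur => //.
  - by case=> [p|] [q|] //=; rewrite eq_sym sm.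
  - by case=> [p|] [q|] //=; case: ifP.
  - by case=> [p|] //=; rewrite eqxx.
  pose P (p q : U) := (tau ^+ 2 - 1) * (b p.1 * b q.1) + (b p.1 * b q.1 - m p.1 q.1)
    + if p == q then m p.1 p.1 - 1 else 0.
  have pP : psd P.
    apply: psdD; last by apply: psd_diag => p; rewrite subr_ge0.
    apply: psdD; last exact: (psd_sub fst pm).
    apply: psdZ; last exact: (psd_rank1 (fun p : U => b p.1)).
    by rewrite subr_ge0 expr_ge1 // (le_trans _ tau1).
  apply: eq_psd (psd_option pP) => -[p|] [q|] //=; rewrite ?mul1r ?mulr1 ?subrr //.
  by rewrite /P; case: eqP => [->|_]; ring.
(* Each coefficient is spread evenly over [N.+1] copies, so the altered diagonal contributes only a
   term of order [1 / N]. *)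
pose c' (u : option U) := if u is Some p then c p.1 / N.+1%:R else 0.
have cN t (F : T -> R) : \sum_(p : U | p.1 == t) F p.1 / N.+1%:R = F t.
  rewrite (eq_bigl (fun p : U => (p.1 == t) && true)); last by move=> p; rewrite andbT.
  rewrite -(pair_big (fun i => i == t) predT (fun i _ => F i / N.+1%:R)) /= big_pred1_eq.
  by rewrite sumr_const card_ord -[_ *+ _]mulr_natr divfK ?pnatr_eq0.
move=> /(_ c'); rewrite qformB (qform_rank1 (fun u => f (mm None u))) big_option mul0r add0r.
rewrite (qform_option (fun u v => f (mm u v))) //.
rewrite (eq_qform (L := fun p q : U => f (m p.1 q.1) + if p == q then f 1 - f (m p.1 p.1) else 0));
  last by move=> p q /=; case: eqP => [->|_]; ring.
rewrite qformD (qform_sub fst (fun i j => f (m i j))) qform_diag /=.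
have -> : (fun t => \sum_(p : U | p.1 == t) c p.1 / N.+1%:R) = c.
  by apply/funext => t; rewrite (cN t c).
have -> : \sum_(p : U) c p.1 / N.+1%:R * f (tau * b p.1) = \sum_i c i * f (tau * b i).
  rewrite (partition_big fst predT) //=; apply: eq_bigr => i _.
  by rewrite -[RHS](cN i (fun i => c i * f (tau * b i))); apply: eq_bigr => p _; ring.
have -> : \sum_(p : U) (c p.1 / N.+1%:R) ^+ 2 * (f 1 - f (m p.1 p.1)) =
    - ((\sum_i c i ^+ 2 * (f (m i i) - f 1)) / N.+1%:R).
  rewrite -mulNr -sumrN mulr_suml (partition_big fst predT) //=; apply: eq_bigr => i _.
  rewrite -[RHS](cN i (fun i => - (c i ^+ 2 * (f (m i i) - f 1)) / N.+1%:R)).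
  by apply: eq_bigr => p _; rewrite expr2; ring.
set D := \sum_i _; set S := \sum_i _; set Q := qform _ _ => h.
rewrite -ler_pdivlMr ?ltr0n // lerBlDr. move: h; set E := S / _; set G := D ^+ 2 => h; rewrite -subr_ge0; apply: (le_trans h); rewrite le_eqVlt; apply/orP; left; apply/eqP; ring.
Qed.

(** A two-point kernel with diagonal [s], [t] and off-diagonal entry [u]. With this [b] the matrix
    [b b^T - m] has a single nonzero entry at most, on the diagonal and nonnegative by
    hypothesis. *)
Lemma preserver_logconcave (s t u : R) : 1 <= s -> 1 <= t -> 1 <= u -> s * t <= u ^+ 2 ->
  f s * f t <= f u ^+ 2.
Proof.
move=> s1 t1 u1 stu.
have s0 : 0 < s by exact: lt_le_trans s1.
have rs1 : 1 <= Num.sqrt s by rewrite -[1]sqrtr1 ler_wsqrtr.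
have rs0 : 0 < Num.sqrt s by exact: lt_le_trans rs1.
pose b (i : bool) := if i then Num.sqrt s else u / Num.sqrt s.
pose m (i j : bool) := if i then (if j then s else u) else if j then u else t.
pose tau := 1 + Num.sqrt s.
have tb i : 1 <= tau * b i.
  rewrite /tau /b; case: i; first by nra.
  rewrite mulrDl mul1r [Num.sqrt s * _]mulrC divfK ?gt_eqF //.
  by apply: (le_trans u1); rewrite lerDr divr_ge0 // ltW // (lt_le_trans ltr01).
pose x := f (tau * b false); pose y := f (tau * b true).
have x1 : 1 <= x by exact: hf.
have y1 : 1 <= y by exact: hf.
have pm : psd (fun i j => b i * b j - m i j).
  apply: (@eq_psd _ _ (fun i j => if i == j then (if i then 0 else u ^+ 2 / s - t) else 0)).
    have rsE : Num.sqrt s * Num.sqrt s = s by rewrite -expr2 sqr_sqrtr // ltW.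
    move=> [] [] /=; rewrite /b /m ?rsE ?subrr //.
    + by rewrite mulrC divfK ?gt_eqF // subrr.
    + by rewrite divfK ?gt_eqF // subrr.
    + by rewrite mulrACA -invfM rsE expr2.
  by apply: psd_diag => -[] //; rewrite subr_ge0 ler_pdivlMr // mulrC.
(* The coefficients [x], [- y] annihilate the linear form on the right. What remains is an upper
   bound on [x ^+ 2 * f s + y ^+ 2 * f t], from which the arithmetic-geometric mean inequality
   eliminates [x] and [y]. *)
have := @preserver_qform _ b m tau (fun i => if i then x else - y) _ tb _ _ pm.
rewrite /qform !big_bool /= -/x -/y => h.
have {}h : x ^+ 2 * f s + y ^+ 2 * f t <= 2 * (x * y * f u).
  have -> : 2 * (x * y * f u) = x ^+ 2 * f s + y ^+ 2 * f t -
    (x * x * f s + x * - y * f u + (- y * x * f u + - y * - y * f t)) by ring.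
  rewrite lerBrDr gerDl; apply: le_trans (h _ _ _) _.
  - by rewrite /tau lerDl ltW.
  - by move=> [] [].
  - by move=> [] [].
  - by rewrite [_ + _](_ : _ = 0) ?expr0n //; ring.
have fs := hf s1; have ft := hf t1; have fu := hf u1.
have xy : 0 < 2 * (x * y) by nra.
have h2 : (2 * (x * y)) ^+ 2 * (f s * f t) <= (2 * (x * y)) ^+ 2 * f u ^+ 2.
  apply: (@le_trans _ _ ((x ^+ 2 * f s + y ^+ 2 * f t) ^+ 2)).
    rewrite -subr_ge0 (_ : _ - _ = (x ^+ 2 * f s - y ^+ 2 * f t) ^+ 2) ?sqr_ge0 //; ring.
  rewrite -exprMn; apply: lerXn2r; rewrite ?nnegrE; [| |by move: h; rewrite !mulrA].
    by apply: addr_ge0; apply: mulr_ge0; rewrite ?sqr_ge0; lra.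
  by apply: mulr_ge0; [exact: ltW|lra].
by move: h2; rewrite ler_pM2l // exprn_gt0.
Qed.

Lemma preserver_nondecreasing (s t : R) : 1 <= s -> s <= t -> f s <= f t.
Proof.
move=> s1 st; have t1 := le_trans s1 st.
have h : f s * f s <= f t ^+ 2 by apply: preserver_logconcave => //; nra.
have fs := hf s1; have ft := hf t1; nra.
Qed.

(** Three points at positions [0], [1], [-1] with kernel [t - e * (x i * x j)], tested against the
    second difference [-2], [1], [1]; as [b] is constant, the linear form vanishes. *)
Lemma preserver_concave (t e : R) : 0 <= e -> 1 <= t - e ->
  f (t - e) + f (t + e) <= 2 * f t.
Proof.
move=> e0 te1; have t1 : 1 <= t by lra.
have rt1 : 1 <= Num.sqrt t by rewrite -[1]sqrtr1 ler_wsqrtr.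
pose x (i : option bool) : R := if i is Some i then if i then 1 else -1 else 0.
pose m i j := t - e * (x i * x j).
pose c (i : option bool) : R := if i is None then -2 else 1.
have pm : psd (fun i j => Num.sqrt t * Num.sqrt t - m i j).
  apply: (@eq_psd _ _ (fun i j => e * (x i * x j))); last by apply/psdZ/psd_rank1.
  by move=> i j; rewrite /m -expr2 sqr_sqrtr; [ring|lra].
have : qform (fun i j => f (m i j)) c <= 0.
  apply: le_trans (@preserver_qform _ (fun=> Num.sqrt t) m 1 c (lexx _) _ _ _ pm) _.
  - by move=> _; rewrite mul1r.
  - by move=> i j; rewrite /m [x i * _]mulrC.
  - by move=> [[]|] [[]|]; rewrite /m /=; lra.
  rewrite big_option big_bool /c /= (_ : _ + _ = 0) ?expr0n //; ring.
rewrite /qform !big_option !big_bool /= !big_option !big_bool /= /m /=.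
have -> : t - e * (0 * 0) = t by ring.
have -> : t - e * (0 * 1) = t by ring.
have -> : t - e * (0 * -1) = t by ring.
have -> : t - e * (1 * 0) = t by ring.
have -> : t - e * (-1 * 0) = t by ring.
have -> : t - e * (1 * 1) = t - e by ring.
have -> : t - e * (-1 * -1) = t - e by ring.
have -> : t - e * (1 * -1) = t + e by ring.
have -> : t - e * (-1 * 1) = t + e by ring.
move=> h; lra.
Qed.

(** Each point is taken twice with opposite signs, and the kernel is multiplied by [lam] between the
    two families. The signs cancel the linear form and leave minus twice the form in question. *)
Lemma preserver_hankel_diff (T : finType) (b : T -> R) (lam : R) : 1 <= lam ->
    (forall i, 1 <= b i) ->
  psd (fun i j => f (lam * (b i * b j)) - f (b i * b j)).
Proof.
move=> lam1 b1 c; have lam0 : 0 <= lam by lra.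
have rl1 : 1 <= Num.sqrt lam by rewrite -[1]sqrtr1 ler_wsqrtr.
pose b' (p : T * bool) := Num.sqrt lam * b p.1.
pose m (p q : T * bool) := (if p.2 == q.2 then 1 else lam) * (b p.1 * b q.1).
pose c' (p : T * bool) := c p.1 * if p.2 then 1 else -1.
have pm : psd (fun p q => b' p * b' q - m p q).
  apply: (@eq_psd _ _ (fun p q => (lam - 1) * (b p.1 * b q.1 * (if p.2 == q.2 then 1 else 0)))).
    move=> p q; rewrite /b' /m [Num.sqrt lam * _ * _](_ : _ = Num.sqrt lam ^+ 2 * (b p.1 * b q.1)); last by ring.
    by rewrite sqr_sqrtr //; case: eqP => _; ring.
  apply: psdZ; first by rewrite subr_ge0.
  apply: (psd_scale (fun p : T * bool => b p.1)).
  exact: (psd_sub snd (psd_diag (fun i : bool => ler01))).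
have bb i j : 1 <= b i * b j by have := b1 i; have := b1 j; nra.
have : qform (fun p q => f (m p q)) c' <= 0.
  apply: le_trans (@preserver_qform _ b' m 1 c' (lexx _) _ _ _ pm) _.
  - by move=> p; rewrite /b' mul1r; have := b1 p.1; nra.
  - by move=> p q; rewrite /m eq_sym [b q.1 * _]mulrC.
  - by move=> p q; rewrite /m; have := bb p.1 q.1; case: eqP => _; nra.
  rewrite -(pair_bigA _ (fun i s => c' (i, s) * f (1 * b' (i, s)))) /= big1 ?expr0n // => i _.
  by rewrite big_bool /c' /=; ring.
have -> : qform (fun p q => f (m p q)) c' =
    2 * - qform (fun i j => f (lam * (b i * b j)) - f (b i * b j)) c.
  rewrite -qformN -qformZ /qform.
  rewrite -(pair_bigA _ (fun i s => \sum_q c' (i, s) * c' q * f (m (i, s) q))) /=.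
  apply: eq_bigr => i _; rewrite big_bool /=.
  rewrite -(pair_bigA _ (fun j s => c' (i, true) * c' (j, s) * f (m (i, true) (j, s)))) /=.
  rewrite -(pair_bigA _ (fun j s => c' (i, false) * c' (j, s) * f (m (i, false) (j, s)))) /=.
  rewrite -big_split; apply: eq_bigr => j _ /=.
  by rewrite !big_bool /c' /m /= !mul1r; ring.
move=> h; lra.
Qed.

End Necessity.

(** * Midpoint concave functions and growth exponents *)

Section MidpointConcave.
Variables (R : realType).

Section Sequence.
Variable G : nat -> R.
Hypothesis Gc : forall k, G k + G k.+2 <= 2 * G k.+1.

Lemma concave_seq_incr l k : G (k + l).+1 - G (k + l)%N <= G l.+1 - G l.
Proof.
elim: k => [|k IHk]; first by rewrite add0n.
by apply: le_trans IHk; rewrite addSn; have := Gc (k + l)%N; lra.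
Qed.

Lemma concave_seq_shift k l : G (k + l)%N - G k <= G l - G 0.
Proof.
elim: l => [|l IHl]; first by rewrite addn0 !subrr.
by have := concave_seq_incr l k; rewrite addnS; lra.
Qed.

Lemma concave_seq_last l : l%:R * (G l.+1 - G l) <= G l - G 0.
Proof.
elim: l => [|l IHl]; first by rewrite mul0r subrr.
have := concave_seq_incr l 1; rewrite add1n => h.
apply: (@le_trans _ _ (l.+1%:R * (G l.+1 - G l))); first by rewrite ler_wpM2l.
by rewrite -natr1 mulrDl mul1r; lra.
Qed.

End Sequence.

Variable g : R -> R.
Hypothesis gnd : forall x y, 0 <= x -> x <= y -> g x <= g y.
Hypothesis gmc : forall x h, 0 <= x -> 0 <= h -> g x + g (x + 2 * h) <= 2 * g (x + h).

Let grid_concave x d : 0 <= x -> 0 <= d ->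
  forall k : nat, g (x + k%:R * d) + g (x + k.+2%:R * d) <= 2 * g (x + k.+1%:R * d).
Proof.
move=> x0 d0 k; have := @gmc (x + k%:R * d) d _ d0.
have -> : x + k%:R * d + 2 * d = x + k.+2%:R * d by rewrite -[k.+2%:R]natr1 -natr1; ring.
have -> : x + k%:R * d + d = x + k.+1%:R * d by rewrite -natr1; ring.
by apply; rewrite addr_ge0 ?mulr_ge0.
Qed.

(** The [n] steps of length [d] that end at [x] stay in the half line, and the next increment is at
    most each of theirs. *)
Lemma midconcave_local x d (n : nat) : 0 <= d -> n%:R * d <= x ->
  n%:R * (g (x + d) - g x) <= g x - g 0.
Proof.
move=> d0 nd; have y0 : 0 <= x - n%:R * d by rewrite subr_ge0.
have := concave_seq_last (grid_concave y0 d0) n.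
have -> : x - n%:R * d + n.+1%:R * d = x + d by rewrite -natr1; ring.
rewrite subrK mul0r addr0 => /le_trans; apply.
by rewrite lerB // gnd.
Qed.

(** Monotonicity does the work of continuity: increments are compared on a grid of step [h / n.+1],
    at the price of one extra increment, which is of order [1 / n]. *)
Lemma midconcave_incr x y h : 0 <= x -> x <= y -> 0 <= h ->
  g (y + h) - g y <= g (x + h) - g x.
Proof.
move=> x0 xy; rewrite le_eqVlt => /orP[/eqP <-|h0]; first by rewrite !addr0 !subrr.
rewrite -subr_le0; apply: (@archi_le0 _ _ (g (x + h) - g x)) => n.
pose d := h / n.+1%:R; have d0 : 0 < d by rewrite divr_gt0.
have hE : n.+1%:R * d = h by rewrite mulrC divfK // pnatr_eq0.
pose j := Num.truncn ((y - x) / d).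
have /andP[jl ju] : (j%:R <= (y - x) / d < j.+1%:R).
  by apply: truncn_itv; rewrite divr_ge0 ?subr_ge0 // ltW.
move: jl ju; rewrite ler_pdivlMr // ltr_pdivrMr // => jl ju.
pose G k := g (x + k%:R * d).
have Gc : forall k, G k + G k.+2 <= 2 * G k.+1 := grid_concave x0 (ltW d0).
have G0 : G 0%N = g x by rewrite /G mul0r addr0.
have Gn : G n.+1 = g (x + h) by rewrite /G hE.
have y0 := le_trans x0 xy.
(* As [y] lies between the grid points [j] and [j.+1], covering the interval takes [n.+2] steps
   instead of [n.+1]. *)
have h1 : g (y + h) - g y <= G (j + n.+2)%N - G j.
  apply: lerB; apply: gnd.
  - by rewrite addr_ge0 // ltW.
  - by move: ju; rewrite -hE natrD -[n.+2%:R]natr1 -[j.+1%:R]natr1; lra.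
  - by rewrite addr_ge0 // mulr_ge0 // ltW.
  - lra.
have h2 := concave_seq_shift Gc j n.+2.
have h3 := concave_seq_last Gc n.+1.
rewrite -Gn -G0 in h3 *.
apply: (@le_trans _ _ ((G n.+2 - G n.+1) * n.+1%:R)); last by rewrite mulrC.
by rewrite ler_wpM2r //; lra.
Qed.

End MidpointConcave.

Section GrowthExponent.
Variables (R : realType) (phi : R -> R).
Hypothesis nd : forall x y, 0 <= x -> x <= y -> phi x <= phi y.
Hypothesis mc : forall x h, 0 <= x -> 0 <= h -> phi x + phi (x + 2 * h) <= 2 * phi (x + h).

Let incr := midconcave_incr nd mc.

Let psi h (n : nat) := phi (n%:R + h) - phi n%:R.

Let psi_cvg h : 0 <= h -> cvgn (psi h).
Proof.
move=> h0; apply: nonincreasing_is_cvgn.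
  by move=> m n mn; apply: incr => //; rewrite ler_nat.
by exists 0 => _ [n _ <-]; rewrite subr_ge0 nd // lerDl.
Qed.

Let L h := limn (psi h).

Let psiL h : 0 <= h -> psi h @ \oo --> L h.
Proof. exact: psi_cvg. Qed.

(** Increments decrease with their starting point, so this one is squeezed between those at the
    integers [n] and [n + m]. *)
Lemma slope_cvg_shift h k : 0 <= h -> 0 <= k ->
  phi (n%:R + h + k) - phi (n%:R + h) @[n --> \oo] --> L k.
Proof.
move=> h0 k0; pose m := (Num.truncn h).+1.
apply: (@squeeze_cvgr _ _ _ _ (fun n => psi k (n + m)%N) (psi k)).
- apply: nearW => n; apply/andP; split; apply: incr => //.
  + by rewrite addr_ge0.
  + by rewrite natrD lerD2l ltW // truncnS_gt.
  + by rewrite lerDl.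
- have := psiL k0; rewrite -(cvg_shiftn m); exact.
- exact: psiL.
Qed.

Let LD h k : 0 <= h -> 0 <= k -> L (h + k) = L h + L k.
Proof.
move=> h0 k0; apply: cvg_lim => //.
have -> : psi (h + k) = (fun n => psi h n + (phi (n%:R + h + k) - phi (n%:R + h))).
  by apply/funext => n; rewrite /psi addrA; ring.
by apply: cvgD; [exact: psiL|exact: slope_cvg_shift].
Qed.

Let Lnd h k : 0 <= h -> h <= k -> L h <= L k.
Proof.
move=> h0 hk; apply: ler_lim; [exact: psi_cvg|exact/psi_cvg/(le_trans h0)|].
by apply: nearW => n; rewrite lerD2r nd ?lerD2l // addr_ge0.
Qed.

Let L0 : L 0 = 0.
Proof.
rewrite /L (_ : psi 0 = fun=> 0) ?lim_cst //.
by apply/funext => n; rewrite /psi addr0 subrr.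
Qed.

Let Ln h n : 0 <= h -> L (n%:R * h) = n%:R * L h.
Proof.
move=> h0; elim: n => [|n IHn]; first by rewrite !mul0r L0.
by rewrite -natr1 !mulrDl !mul1r LD ?IHn // mulr_ge0.
Qed.

(** [L] is additive and monotone: comparing [n%:R * h] with its integer part bounds [n] times the
    defect by [L 1], for every [n]. *)
Lemma slope_linear h : 0 <= h -> L h = L 1 * h.
Proof.
move=> h0; have L1 : 0 <= L 1 by rewrite -L0 Lnd.
have bnd n : `|n%:R * L h - n%:R * (L 1 * h)| <= L 1.
  pose k := Num.truncn (n%:R * h).
  have /andP[kl ku] : k%:R <= n%:R * h < k.+1%:R by apply: truncn_itv; rewrite mulr_ge0.
  have h1 : k%:R * L 1 <= n%:R * L h.
    by rewrite -!Ln // mulr1 Lnd.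
  have h2 : n%:R * L h <= k.+1%:R * L 1.
    by rewrite -!Ln // mulr1 Lnd ?mulr_ge0 // ltW.
  rewrite ler_norml; apply/andP; split.
    by move: ku h1; rewrite -natr1; nra.
  by move: kl h2; rewrite -natr1; nra.
apply/eqP; rewrite eq_le; apply/andP; split; rewrite -subr_le0;
  apply: (@archi_le0 _ _ (L 1)) => n; have := bnd n.+1; rewrite ler_norml => /andP[]; nra.
Qed.

Lemma slope_lower x h : 0 <= x -> 0 <= h -> L 1 * h <= phi (x + h) - phi x.
Proof.
move=> x0 h0; rewrite -slope_linear //.
pose m := (Num.truncn x).+1.
have := psiL h0; rewrite -(cvg_shiftn m) => /cvgr_to_le; apply.
apply: nearW => n; apply: incr => //; apply: (@le_trans _ _ m%:R); last by rewrite ler_nat leq_addl.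
by rewrite ltW // truncnS_gt.
Qed.

Lemma growth_exponent : exists2 alpha, 0 <= alpha &
  (forall h, 0 <= h -> phi (n%:R + h) - phi n%:R @[n --> \oo] --> alpha * h) /\
  (forall x h, 0 <= x -> 0 <= h -> alpha * h <= phi (x + h) - phi x).
Proof.
exists (L 1); first by rewrite -L0 Lnd.
by split=> [h h0|]; [rewrite -slope_linear //; exact: psiL|exact: slope_lower].
Qed.

End GrowthExponent.

(** The discriminant inequality; if [K true true] is zero, the form is affine in the first
    coefficient, which forces the off-diagonal entry to vanish. *)
Lemma psd_bool_det (R : realType) (K : bool -> bool -> R) :
  K true false = K false true -> psd K -> K true false ^+ 2 <= K true true * K false false.
Proof.
move=> sK pK; have q x y : 0 <= x ^+ 2 * K true true + 2 * (x * y * K true false) + y ^+ 2 * K false false.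
  have := pK (fun i => if i then x else y); rewrite /qform !big_bool /= -sK => h.
  by rewrite (le_trans h) // le_eqVlt; apply/orP; left; apply/eqP; ring.
have tt0 : 0 <= K true true by have := q 1 0; rewrite !(expr1n, expr0n) /=; lra.
have [t0|t0] := eqVneq (K true true) 0.
  rewrite t0 mul0r; have h n : `|K true false| * n.+1%:R <= 1 + K false false.
    have := q (n.+1%:R * Num.sg (- K true false)) 1; rewrite t0 mulr0 add0r expr1n mulr1 mul1r.
    rewrite -mulrA sgrN mulNr -normrEsg; have := normr_ge0 (K true false).
    have : 0 <= n.+1%:R :> R by []. nra.
  have := archi_le0 h; rewrite normr_le0 => /eqP->; by rewrite expr0n.
have tp : 0 < K true true by rewrite lt_def t0.
have := q (- K true false) (K true true).
rewrite (_ : _ + _ = K true true * (K true true * K false false - K true false ^+ 2)); last by ring.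
by rewrite pmulr_rge0 // subr_ge0.
Qed.

(** * The growth exponent of a preserver *)

Section Exponent.
Variables (R : realType) (f : R -> R).
Hypothesis hf : forall t, 1 <= t -> 1 <= f t.
Hypothesis pf : LG_preserver f.

Let expR1 (x : R) : 0 <= x -> 1 <= expR x.
Proof. by move=> x0; rewrite -expR0 ler_expR. Qed.

Let f0 t : 1 <= t -> 0 < f t.
Proof. by move=> /hf; exact: lt_le_trans. Qed.

Lemma preserver_exponent : exists2 alpha, 0 <= alpha &
  (forall lam, 1 <= lam ->
     f (lam * expR n%:R) / f (expR n%:R) @[n --> \oo] --> lam `^ alpha) /\
  (forall lam t, 1 <= lam -> 1 <= t -> lam `^ alpha * f t <= f (lam * t)).
Proof.
pose phi (x : R) := ln (f (expR x)).
have [x y x0 xy|x h x0 h0|a a0 [al ab]] := @growth_exponent R phi.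
- rewrite ler_ln ?posrE ?f0 ?expR1 ?(le_trans x0) //.
  by apply: preserver_nondecreasing => //; rewrite ?expR1 // ler_expR.
- have xh : 0 <= x + h by exact: addr_ge0.
  have x2h : 0 <= x + 2 * h by rewrite addr_ge0 // mulr_ge0.
  rewrite -lnM ?posrE ?f0 ?expR1 // [2 * ln _]mulr_natl -lnXn ?f0 ?expR1 //.
  rewrite ler_ln ?posrE ?mulr_gt0 ?exprn_gt0 ?f0 ?expR1 //.
  apply: preserver_logconcave; rewrite ?expR1 //.
  rewrite -expRD -expRM_natl le_eqVlt; apply/orP; left; apply/eqP; congr expR; ring.
exists a => //; split => [lam lam1|lam t lam1 t1].
- have lam0 : 0 < lam by exact: lt_le_trans lam1.
  have -> : lam `^ a = expR (a * ln lam) by rewrite mulrC expRM lnK.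
  have h := al (ln lam) (ln_ge0 lam1).
  have -> : (fun n : nat => f (lam * expR n%:R) / f (expR n%:R)) =
     (fun n : nat => expR (phi (n%:R + ln lam) - phi n%:R)).
    apply/funext => n; rewrite expRB /phi !lnK ?posrE ?f0 ?expR1 ?addr_ge0 ?ln_ge0 //.
    by rewrite expRD lnK ?posrE // [lam * _]mulrC.
  by apply: continuous_cvg => //; exact: continuous_expR.
have lam0 : 0 < lam by exact: lt_le_trans lam1.
have t0 : 0 < t by exact: lt_le_trans t1.
have := ab (ln t) (ln lam) (ln_ge0 t1) (ln_ge0 lam1).
rewrite lerBrDr /phi expRD !lnK ?posrE // -[a * _ + _ <= _]ler_expR expRD [a * _]mulrC expRM.
by rewrite !lnK ?posrE ?f0 // ?mulr_ege1 // [lam * t]mulrC.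
Qed.

Variable alpha : R.
Hypothesis a0 : 0 <= alpha.
Hypothesis ra : forall lam, 1 <= lam ->
  f (lam * expR n%:R) / f (expR n%:R) @[n --> \oo] --> lam `^ alpha.
Hypothesis rl : forall lam t, 1 <= lam -> 1 <= t -> lam `^ alpha * f t <= f (lam * t).

(** Concavity at [2 ^+ n + 1] with step [2 ^+ n] makes [f] grow at most linearly along powers of
    two, while [rl] makes it grow at least like the power [alpha]. *)
Lemma exponent_le1 : alpha <= 1.
Proof.
have lin n : f (2 ^+ n + 1) <= 2 ^+ n * f 2.
  elim: n => [|n IHn]; first by rewrite expr0 mul1r.
  have p1 : 1 <= 2 ^+ n :> R by rewrite exprn_ege1 // ler1n.
  have f1 := hf (lexx 1).
  have {}h : f (2 ^+ n.+1 + 1) <= 2 * f (2 ^+ n + 1).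
    have := @preserver_concave _ _ pf (2 ^+ n + 1) (2 ^+ n).
    rewrite [_ + 1 - _]addrAC subrr add0r (_ : _ + 2 ^+ n = 2 ^+ n.+1 + 1); last by rewrite exprS; ring.
    by move=> /(_ _ _); lra.
  by apply: (le_trans h); rewrite exprS -mulrA ler_pM2l.
rewrite -subr_le0 -(pmulr_lle0 _ (ln_gt0 (ltr1n R 2))).
apply: (@archi_le0 _ _ (ln (f 2))) => n.
have p1 m : 1 <= 2 ^+ m :> R by rewrite exprn_ege1 // ler1n.
have h : (2 ^+ n.+1) `^ alpha <= 2 ^+ n.+1 * f 2.
  apply: le_trans (lin _); apply: (@le_trans _ _ (f (2 ^+ n.+1 * 1))).
    apply: le_trans (rl (p1 _) (lexx 1)); rewrite ler_peMr ?powR_ge0 //; exact: hf.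
  by rewrite mulr1 preserver_nondecreasing // lerDl.
have f2 : 0 < f 2 by apply: f0; rewrite ler1n.
have {}h : ln ((2 ^+ n.+1) `^ alpha) <= ln (2 ^+ n.+1 * f 2).
  by rewrite ler_ln ?posrE ?powR_gt0 ?mulr_gt0 ?exprn_gt0.
move: h; rewrite ln_powR lnM ?posrE ?exprn_gt0 // lnXn // -mulr_natr.
lra.
Qed.

(** The scale [tau] of [preserver_qform] is sent to infinity: divided by [f (expR n%:R)], the linear
    form tends to a multiple of the constraint on [c], that is, to zero. *)
Lemma preserver_cnd (T : finType) (b : T -> R) (m : T -> T -> R) c :
    (forall i, 0 < b i) -> (forall i j, m i j = m j i) -> (forall i j, 1 <= m i j) ->
    psd (fun i j => b i * b j - m i j) -> \sum_i c i * b i `^ alpha = 0 ->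
  qform (fun i j => f (m i j)) c <= 0.
Proof.
move=> b0 sm m1 pm cb.
have [i1 _|noT] := pickP (@predT T); last first.
  by rewrite /qform big1 // => i _; have := noT i.
(* Normalizing by the smallest [b i0] keeps every ratio [b i / b i0] at least [1], the range covered
   by [ra]. *)
have [i0 _ i0min] := @arg_minP _ R T i1 predT b isT.
pose r i (n : nat) := f (b i / b i0 * expR n%:R) / f (expR n%:R).
have rr i : r i @ \oo --> (b i / b i0) `^ alpha.
  by apply: ra; rewrite ler_pdivlMr // mul1r i0min.
pose eps n := \sum_i c i * r i n.
have eps0 : eps @ \oo --> (0 : R).
  rewrite (_ : 0 = \sum_i c i * (b i / b i0) `^ alpha).
    by apply: cvg_sumr => i; apply: cvgM; [exact: cvg_cst|exact: rr].
  rewrite (eq_bigr (fun i => c i * b i `^ alpha * (b i0)^-1 `^ alpha)).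
    by rewrite -mulr_suml cb mul0r.
  by move=> i _; rewrite powRM ?mulrA // ?ltW // invr_gt0.
(* As [r i0 n = 1], subtracting [eps n] at [i0] makes the linear form vanish exactly, and the
   perturbation tends to zero. *)
pose c' n i := c i - eps n * (i == i0)%:R.
have c'c : qform (fun i j => f (m i j)) (c' n) @[n --> \oo] --> qform (fun i j => f (m i j)) c.
  have cc i : c' n i @[n --> \oo] --> c i.
    rewrite -[X in _ --> X]subr0; apply: cvgB; first exact: cvg_cst.
    by rewrite -(mul0r ((i == i0)%:R : R)); apply: cvgM => //; exact: cvg_cst.
  apply: cvg_sumr => i; apply: cvg_sumr => j.
  by apply: cvgM; [exact: cvgM|exact: cvg_cst].
apply: (cvgr_to_le c'c).
near=> n; pose tau := expR n%:R / b i0.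
have tb i : 1 <= tau * b i.
  rewrite /tau mulrAC -mulrA mulr_ege1 ?expR1 //.
  by rewrite ler_pdivlMr // mul1r i0min.
have tau1 : 1 <= tau.
  rewrite /tau ler_pdivlMr // mul1r; apply: (@le_trans _ _ n%:R).
    near: n; exact: nbhs_infty_ger.
  by apply: le_trans (expR_ge1Dx _); rewrite lerDr.
apply: (le_trans (@preserver_qform _ _ pf T b m tau (c' n) tau1 tb sm m1 pm)).
rewrite [X in X ^+ 2](_ : _ = 0) ?expr0n //.
have ft : 0 < f (expR n%:R) by apply: f0; rewrite expR1.
rewrite (eq_bigr (fun i => c' n i * r i n * f (expR n%:R))); last first.
  move=> i _; rewrite -mulrA divfK ?gt_eqF //; congr (_ * f _).
  by rewrite /tau; ring.
rewrite -mulr_suml; apply/eqP; rewrite mulf_eq0; apply/orP; left; apply/eqP.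
rewrite (eq_bigr (fun i => c i * r i n - eps n * ((i == i0)%:R * r i n))).
  rewrite sumrB -/(eps n) -mulr_sumr (bigD1 i0) //= big1 ?addr0.
    by rewrite eqxx mul1r /r divff ?gt_eqF // mul1r divff ?gt_eqF // mulr1 subrr.
  by move=> i /negbTE ->; rewrite mul0r.
by move=> i _; rewrite /c'; ring.
Unshelve. all: by end_near. Qed.

End Exponent.

(** * Hankel functions attached to a preserver *)

Definition hankel_psd (R : realType) (H : R -> R) :=
  forall (T : finType) (y : T -> R), (forall i, 0 <= y i) -> psd (fun i j => H (y i + y j)).

Lemma hankel_psd_ge0 (R : realType) (H : R -> R) x : hankel_psd H -> 0 <= x -> 0 <= H x.
Proof.
move=> hH x0; have h := hH unit (fun=> x / 2) (fun=> divr_ge0 x0 (ler0n _ _)) (fun=> 1).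
move: h; rewrite /qform (bigD1 tt) //= (bigD1 tt) //= !big1 ?addr0 => [|[]//|[]//].
by rewrite !mul1r -splitr.
Qed.

Section Exponent.
Variables (R : realType) (f : R -> R).
Hypothesis hf : forall t, 1 <= t -> 1 <= f t.
Hypothesis pf : LG_preserver f.

Let expR1 (x : R) : 0 <= x -> 1 <= expR x.
Proof. by move=> x0; rewrite -expR0 ler_expR. Qed.

Let f0 t : 1 <= t -> 0 < f t.
Proof. by move=> /hf; exact: lt_le_trans. Qed.

Lemma preserver_diff_hankel (u : R) : 0 <= u ->
  hankel_psd (fun x => f (expR (u + 1 + x)) - f (expR (u + x))).
Proof.
move=> u0 T y y0; pose b i := expR (u / 2 + y i).
have bb i j : b i * b j = expR (u + (y i + y j)).
  by rewrite -expRD; congr expR; rewrite [u in RHS]splitr; ring.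
have lam1 : 1 <= expR 1 :> R by rewrite expR1.
have b1 i : 1 <= b i by rewrite expR1 // addr_ge0 // divr_ge0.
apply: eq_psd (preserver_hankel_diff pf lam1 b1) => i j.
by rewrite bb -expRD addrA [1 + u]addrC.
Qed.

Variable alpha : R.
Hypothesis a0 : 0 <= alpha.
Hypothesis ra : forall lam, 1 <= lam ->
  f (lam * expR n%:R) / f (expR n%:R) @[n --> \oo] --> lam `^ alpha.
Hypothesis rl : forall lam t, 1 <= lam -> 1 <= t -> lam `^ alpha * f t <= f (lam * t).

Section Positive.
Hypothesis ap : 0 < alpha.

Let F (n : nat) := f (expR n%:R).
Let V (n : nat) := F n.+1 - F n.
Let A := expR alpha.

Let A1 : 1 < A. Proof. by rewrite expR_gt1. Qed.

Let Fp n : 0 < F n. Proof. by apply: f0; rewrite expR1. Qed.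

Let FS n : F n.+1 = f (expR 1 * expR n%:R).
Proof. by rewrite /F -natr1 expRD mulrC. Qed.

Let e1a : expR 1 `^ alpha = A :> R.
Proof. by rewrite -expRM mul1r. Qed.

Let FA n : A * F n <= F n.+1.
Proof. by rewrite FS -e1a; apply: rl; rewrite ?expR1. Qed.

Let V_lower n : (A - 1) * F n <= V n.
Proof. by rewrite mulrBl mul1r lerB. Qed.

Let Vp n : 0 < V n.
Proof. by apply: lt_le_trans (V_lower n); rewrite mulr_gt0 // subr_gt0. Qed.

(** The determinant of the Hankel kernel at the points [n / 2] and [n / 2 + 1], whose pairwise sums
    are [n], [n + 1] and [n + 2]. *)
Let V_logconvex n : V n.+1 ^+ 2 <= V n * V n.+2.
Proof.
pose y (i : bool) : R := if i then n%:R / 2 else n%:R / 2 + 1.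
have := preserver_diff_hankel (lexx 0) (y := y) => /(_ _)/psd_bool_det h.
have VE m x : x = m%:R -> f (expR (0 + 1 + x)) - f (expR (0 + x)) = V m.
  by move=> ->; rewrite /V /F !add0r -natr1 [1 + _]addrC.
have e1 : y true + y true = n%:R by rewrite /y -splitr.
have e2 : y true + y false = n.+1%:R by rewrite /y addrA -splitr natr1.
have e3 : y false + y false = n.+2%:R.
  by rewrite /y addrACA -splitr -addn2 natrD.
rewrite -(VE _ _ e1) -(VE _ _ e2) -(VE _ _ e3); apply: h.
  by rewrite [y false + y true]addrC.
by move=> []; rewrite /y ?addr_ge0 // divr_ge0.
Qed.

(** By log-convexity the quotients of [V] are nondecreasing, hence below their limit; this is [A],
    because the quotients of [F] tend to [A] and [A] exceeds [1]. *)
Let ratio n : V n.+1 <= A * V n.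
Proof.
pose q m := V (m.+1) / V m.
have qnd : nondecreasing_seq q.
  apply/nondecreasing_seqP => m; rewrite /q ler_pdivrMr // mulrAC ler_pdivlMr //.
  by rewrite -expr2 mulrC; exact: V_logconvex.
suff qA : q @ \oo --> A.
  rewrite -ler_pdivrMr //; have := nondecreasing_cvgn_le qnd (cvgP _ qA) n.
  by rewrite (cvg_lim _ qA).
pose r m := F m.+1 / F m.
have rA : r @ \oo --> A.
  by rewrite -e1a; have := ra (expR1 ler01); under eq_fun do rewrite -FS.
have rA' : (fun m => r m.+1) @ \oo --> A.
  by have := rA; rewrite -(cvg_shiftn 1); under eq_fun do rewrite addn1.
have -> : q = (fun m => r m * ((r m.+1 - 1) / (r m - 1))).
  have r1 m : r m - 1 = V m / F m by rewrite /V mulrBl divff ?gt_eqF.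
  by apply/funext => m; rewrite !r1 /q /r; field; rewrite !gt_eqF.
rewrite [X in _ --> X](_ : A = A * ((A - 1) / (A - 1))); last first.
  by rewrite divff ?mulr1 // gt_eqF // subr_gt0.
have h1 : r m.+1 - 1 @[m --> \oo] --> A - 1 by apply: cvgB; [exact: rA'|exact: cvg_cst].
have h2 : r m - 1 @[m --> \oo] --> A - 1 by apply: cvgB; [exact: rA|exact: cvg_cst].
apply: cvgM; first exact: rA.
by apply: cvgM; [exact: h1|apply: cvgV; [rewrite gt_eqF // subr_gt0|exact: h2]].
Qed.

Let G n := F n / A ^+ n.

Let G_cvg : cvgn G.
Proof.
apply: nondecreasing_is_cvgn.
  apply/nondecreasing_seqP => n; rewrite /G exprS invfM mulrA ler_pM2r.
    by rewrite ler_pdivlMr ?(lt_trans ltr01) // mulrC.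
  by rewrite invr_gt0 exprn_gt0 // (lt_trans ltr01).
have Ap : 0 < A by exact: lt_trans A1.
have Vn n : V n <= A ^+ n * V 0%N.
  elim: n => [|n IHn]; first by rewrite expr0 mul1r.
  by apply: le_trans (ratio n) _; rewrite exprS -mulrA ler_pM2l.
exists (V 0%N / (A - 1)) => _ [n _ <-].
rewrite /G ler_pdivrMr ?exprn_gt0 // mulrAC ler_pdivlMr ?subr_gt0 // mulrC [V _ * _]mulrC.
exact: le_trans (V_lower n) _.
Qed.

Let C := limn G.

Let G_nd x h : 1 <= x -> 1 <= h -> f x / x `^ alpha <= f (h * x) / (h * x) `^ alpha.
Proof.
move=> x1 h1; have x0 : 0 < x by exact: lt_le_trans x1. have h0 : 0 < h by exact: lt_le_trans h1.
have -> : f (h * x) / (h * x) `^ alpha = f (h * x) / h `^ alpha / x `^ alpha.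
  by rewrite powRM ?(ltW x0) ?(ltW h0) // invfM mulrA.
rewrite ler_pM2r ?invr_gt0 ?powR_gt0 //.
by rewrite ler_pdivlMr ?powR_gt0 // mulrC rl.
Qed.

Let GE n : G n = f (expR n%:R) / expR n%:R `^ alpha.
Proof. by rewrite /G /F /A -expRM -expRM_natl. Qed.

Let f_upper t : 1 <= t -> f t <= C * t `^ alpha.
Proof.
move=> t1; have t0 : 0 < t by exact: lt_le_trans t1.
rewrite -ler_pdivrMr ?powR_gt0 //; apply: limr_ge => //.
near=> n; rewrite GE -[expR n%:R](divfK (lt0r_neq0 t0)); apply: G_nd => //.
rewrite ler_pdivlMr // mul1r; apply: (@le_trans _ _ n%:R).
  by near: n; exact: nbhs_infty_ger.
by apply: le_trans (expR_ge1Dx _); rewrite lerDr.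
Unshelve. all: by end_near. Qed.

Let f_cvg t : 1 <= t ->
  f (expR n%:R * t) / expR n%:R `^ alpha @[n --> \oo] --> C * t `^ alpha.
Proof.
move=> t1; have t0 : 0 < t by exact: lt_le_trans t1.
apply: (@squeeze_cvgr _ _ _ _ (fun n => G n * t `^ alpha) (fun=> C * t `^ alpha)).
- apply: nearW => n; have e0 := expR_gt0 (n%:R : R).
  have ee : (expR n%:R * t) `^ alpha = expR n%:R `^ alpha * t `^ alpha.
    by rewrite powRM ?expR_ge0 // ltW.
  apply/andP; split; last first.
    rewrite ler_pdivrMr ?powR_gt0 // -mulrA [t `^ _ * _]mulrC -ee f_upper //.
    by rewrite mulr_ege1 // expR1.
  have -> : f (expR n%:R * t) / expR n%:R `^ alpha =
      f (t * expR n%:R) / (t * expR n%:R) `^ alpha * t `^ alpha.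
    by rewrite [t * _]mulrC ee; field; rewrite !gt_eqF ?powR_gt0.
  by rewrite GE ler_pM2r ?powR_gt0 // G_nd // expR1.
- by apply: cvgM; [exact: G_cvg|exact: cvg_cst].
- exact: cvg_cst.
Qed.

(** The constant [C] is the limit of [f t / t^alpha] along [expR n%:R]. Both conclusions come from
    positivity of the kernel [C * m^alpha - f m], for two choices of [m]. *)
Lemma preserver_positive_exponent : exists2 C', 1 <= C' &
  hankel_psd (fun x => C' * expR (alpha * x) - f (expR x)) /\
  forall x y, 0 <= x -> x <= y ->
    C' * expR (alpha * y) - f (expR y) <= C' * expR (alpha * x) - f (expR x).
Proof.
exists C; first by have := f_upper (lexx 1); rewrite powR1 mulr1; apply: le_trans; exact: hf.
have key (T : finType) (b : T -> R) (m : T -> T -> R) : (forall i, 0 < b i) ->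
    (forall i j, m i j = m j i) -> (forall i j, 1 <= m i j) ->
    psd (fun i j => b i * b j - m i j) -> psd (fun i j => C * m i j `^ alpha - f (m i j)).
  move=> b0 sm m1 pm.
  (* The rescaled terms tend to [2 * C] and [C] times the power of [m i j], so their difference
     leaves exactly one [C]. *)
  apply: (@psd_cvg _ _ (fun n i j => 2 * (f (expR n%:R * m i j) / expR n%:R `^ alpha)
     - (f (expR (n + n)%:R * m i j) / expR (n + n)%:R `^ alpha) - f (m i j))); last first.
    move=> i j; rewrite -[C * _](_ : 2 * (C * m i j `^ alpha) - C * m i j `^ alpha = _); last by ring.
    apply: cvgB; last exact: cvg_cst.
    apply: cvgB; first by apply: cvgM; [exact: cvg_cst|exact: f_cvg].
    have := f_cvg (m1 i j) => /(cvg_comp _ _ (_ : (fun n => (n + n)%N) @ \oo --> \oo)); apply.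
    by apply/cvgnyPge => M; near=> n; apply: (@leq_trans n); [near: n; exact: nbhs_infty_ge|exact: leq_addr].
  move=> n c; pose lam (s : bool) : R := if s then 1 else expR n%:R.
  have lam1 s : 1 <= lam s by case: s; rewrite /lam ?expR1.
  have lam0 s : 0 < lam s by exact: lt_le_trans (lam1 s).
  pose b' (p : T * bool) := b p.1 * lam p.2.
  pose m' (p q : T * bool) := lam p.2 * lam q.2 * m p.1 q.1.
  (* The second copy is scaled by [expR n%:R], and its coefficient offsets that scale to the power
     [alpha]; so [preserver_cnd] applies for every [c]. *)
  pose c' (p : T * bool) := c p.1 * if p.2 then 1 else - (expR n%:R `^ alpha)^-1.
  have e0 : 0 < expR n%:R `^ alpha :> R by rewrite powR_gt0 // expR_gt0.
  have : qform (fun p q => f (m' p q)) c' <= 0.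
    apply: (@preserver_cnd _ _ hf pf alpha ra _ b').
    - by move=> p; rewrite mulr_gt0.
    - by move=> p q; rewrite /m' sm [lam q.2 * _]mulrC.
    - by move=> p q; rewrite /m' !mulr_ege1.
    - apply: eq_psd (psd_scale (fun p : T * bool => lam p.2) (psd_sub fst pm)) => p q.
      by rewrite /b' /m'; ring.
    rewrite -(pair_bigA _ (fun i s => c' (i, s) * b' (i, s) `^ alpha)) /= big1 // => i _.
    rewrite big_bool /c' /b' /= mulr1 powRM ?ltW ?expR_gt0 //.
    by rewrite mulr1 -mulrA mulNr [X in - X]mulrCA mulVf ?gt_eqF // mulr1 mulrN subrr.
  rewrite -oppr_ge0 -qformN; congr (_ <= _).
  rewrite /qform -(pair_bigA _ (fun i s => \sum_q c' (i, s) * c' q * - f (m' (i, s) q))) /=.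
  apply: eq_bigr => i _; rewrite big_bool /=.
  rewrite -(pair_bigA _ (fun j s => c' (i, true) * c' (j, s) * - f (m' (i, true) (j, s)))) /=.
  rewrite -(pair_bigA _ (fun j s => c' (i, false) * c' (j, s) * - f (m' (i, false) (j, s)))) /=.
  rewrite -big_split; apply: eq_bigr => j _ /=.
  rewrite !big_bool /c' /m' /= !mul1r mulr1 -expRD -natrD.
  have -> : expR (n + n)%:R `^ alpha = expR n%:R `^ alpha * expR n%:R `^ alpha :> R.
    by rewrite natrD expRD powRM // expR_ge0.
  by field; rewrite gt_eqF.
have ea x : expR x `^ alpha = expR (alpha * x) by rewrite -expRM mulrC.
split=> [T y y0|x y x0 xy].
  apply: (eq_psd _ (key T (fun i => expR (y i)) (fun i j => expR (y i + y j)) _ _ _ _)).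
  - by move=> i j; rewrite ea.
  - by move=> i; exact: expR_gt0.
  - by move=> i j; rewrite addrC.
  - by move=> i j; rewrite expR1 // addr_ge0.
  - apply: (@eq_psd _ _ (fun _ _ => 0)); last exact: psd_cst.
    by move=> i j; rewrite expRD subrr.
(* With the smaller value on the diagonal, the coefficients [1], [-1] turn positivity of the kernel
   into monotonicity. *)
pose m (i j : bool) := if i == j then expR x else expR y.
have pk : psd (fun i j => C * m i j `^ alpha - f (m i j)).
  apply: (key bool (fun=> expR (y / 2)) m).
  - by move=> _; exact: expR_gt0.
  - by move=> i j; rewrite /m eq_sym.
  - by move=> i j; rewrite /m; case: eqP => _; rewrite expR1 // (le_trans x0).
  - apply: (@eq_psd _ _ (fun i j : bool => if i == j then expR y - expR x else 0)).
      by move=> i j; rewrite -expRD -splitr /m; case: eqP; rewrite ?subrr.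
    by apply: psd_diag => _; rewrite subr_ge0 ler_expR.
have := pk (fun i => if i then 1 else -1).
by rewrite /qform !big_bool /m /= !ea => h; lra.
Unshelve. all: by end_near. Qed.

End Positive.

Section Zero.
Hypothesis az : alpha = 0.

Let F x := f (expR x).

Let Fnd x y : 0 <= x -> x <= y -> F x <= F y.
Proof.
by move=> x0 xy; apply: (preserver_nondecreasing hf pf); rewrite ?expR1 // ler_expR.
Qed.

(** For [alpha = 0] the constraint of [preserver_cnd] only asks that the coefficients sum to zero,
    as [1], [-1] do. *)
Let Fmc x h : 0 <= x -> 0 <= h -> F x + F (x + 2 * h) <= 2 * F (x + h).
Proof.
move=> x0 h0; pose y (i : bool) := if i then x / 2 else x / 2 + h.
have y0 i : 0 <= y i by rewrite /y; case: i; rewrite ?addr_ge0 // divr_ge0.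
have := @preserver_cnd _ _ hf pf alpha ra _ (fun i => expR (y i))
  (fun i j => expR (y i + y j)) (fun i => if i then 1 else -1).
rewrite /qform !big_bool /= => h1.
suff : F x + F (x + 2 * h) - 2 * F (x + h) <= 0 by lra.
apply: le_trans (h1 _ _ _ _ _).
- have -> : x / 2 + x / 2 = x by rewrite -splitr.
  have -> : x / 2 + (x / 2 + h) = x + h by rewrite addrA -splitr.
  have -> : x / 2 + h + x / 2 = x + h by rewrite addrAC -splitr.
  have -> : x / 2 + h + (x / 2 + h) = x + 2 * h by rewrite addrACA -splitr; ring.
  by rewrite /F le_eqVlt; apply/orP; left; apply/eqP; ring.
- by move=> i; exact: expR_gt0.
- by move=> i j; rewrite addrC.
- by move=> i j; rewrite expR1 // addr_ge0.
- apply: (@eq_psd _ _ (fun _ _ => 0)); last exact: psd_cst.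
  by move=> i j; rewrite expRD subrr.
by rewrite az !powRr0; ring.
Qed.

Lemma preserver_zero_exponent : exists2 beta, 0 <= beta &
  (forall h, 0 <= h -> f (expR (n%:R + h)) - f (expR n%:R) @[n --> \oo] --> beta * h) /\
  forall u x y, 0 <= u -> 0 <= x -> x <= y ->
    f (expR (u + 1 + y)) - f (expR (u + y)) <= f (expR (u + 1 + x)) - f (expR (u + x)).
Proof.
have [beta b0 [b1 _]] := growth_exponent Fnd Fmc.
exists beta => //; split=> // u x y u0 x0 xy.
have := @midconcave_incr _ _ Fnd Fmc (u + x) (u + y) 1.
rewrite ![u + 1 + _]addrAC; apply=> //; first exact: addr_ge0.
by rewrite lerD2l.
Qed.

End Zero.
End Exponent.

(** * Compactness of monotone functions on the unit interval *)

Section UnitMonotone.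
Variable R : realType.
Notation mu := (@lebesgue_measure R).

(** Stands for the quantile function of a probability measure on the unit interval; pointwise limits
    of such functions replace weak limits of measures. *)
Definition unit_monotone (q : R -> R) :=
  (forall x y, x <= y -> q x <= q y) /\ (forall v, 0 <= q v <= 1).

Definition mean (q : R -> R) : R := fine (\int[mu]_(v in `[0, 1[) (q v)%:E).

Lemma unit_monotone_measurable (D : set R) (q : R -> R) : measurable D ->
  unit_monotone q -> measurable_fun D (fun v => (q v)%:E).
Proof.
move=> mD [qm _]; apply/measurable_EFinP.
by apply: nondecreasing_measurable => // x y; exact: qm.
Qed.

Lemma integral_steps (g : R -> R) (t : nat -> R) (n : nat) :
    (forall v, 0 <= g v) -> measurable_fun setT g -> t 0%N = 0 -> (forall i, t i <= t i.+1) ->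
  (\int[mu]_(v in `[0%R, t n[) (g v)%:E =
   \sum_(i < n) \int[mu]_(v in `[t i, t i.+1[) (g v)%:E)%E.
Proof.
move=> g0 mg t0 tS; have mgE (D : set R) : measurable D -> measurable_fun D (fun v => (g v)%:E).
  by move=> mD; apply/measurable_EFinP; apply: measurable_funS mg.
have tn k : 0 <= t k by elim: k => [|k]; rewrite ?t0 // => /le_trans; apply.
elim: n => [|n IHn]; first by rewrite big_ord0 t0 set_itvco0 integral_set0.
rewrite big_ord_recr /= -IHn -ge0_integral_setU //=.
- by rewrite -itv_bndbnd_setU ?bnd_simp.
- by apply: mgE; apply: measurableU.
- by move=> x _; rewrite lee_fin.
- apply/disj_setPS => x [] /=; rewrite !in_itv /= => /andP[_ h1] /andP[h2 _].
  by move: h1; rewrite ltNge h2.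
Qed.

Lemma integral_co_cst (a b r : R) : a <= b ->
  (\int[mu]_(v in `[a, b[) r%:E = (r * (b - a))%:E)%E.
Proof.
move=> ab; transitivity (r%:E * mu `[a, b[)%E; first exact: integral_cst.
rewrite lebesgue_measure_itv /= lte_fin; case: ltP => [|ba]; first by rewrite -EFinD -EFinM.
by rewrite mule0 (le_anti (_ : a <= b <= a)) ?ab // subrr mulr0.
Qed.

Lemma unit_monotone_integral (q : R -> R) : unit_monotone q ->
  (\int[mu]_(v in `[0%R, 1%R[) (q v)%:E = (mean q)%:E)%E.
Proof.
move=> [qm q01]; rewrite fineK // ge0_fin_numE; last first.
  by apply: integral_ge0 => v _; rewrite lee_fin; case/andP: (q01 v).
apply: (@le_lt_trans _ _ (\int[mu]_(v in `[0%R, 1%R[) (cst 1%:E v))%E).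
  apply: ge0_le_integral => //=.
  - by move=> v _; rewrite lee_fin; case/andP: (q01 v).
  - exact: unit_monotone_measurable.
  - by move=> v _; rewrite lee_fin; case/andP: (q01 v).
by rewrite (@integral_co_cst 0 1 1) // ltry.
Qed.

(* The rate does not depend on [q], which makes [mean] continuous for pointwise limits, even along an
   ultrafilter, where dominated convergence is not available. *)
Lemma mean_riemann (q : R -> R) (n : nat) : unit_monotone q ->
  `|mean q - (\sum_(i < n.+1) q (i%:R / n.+1%:R)) / n.+1%:R| <= n.+1%:R^-1.
Proof.
move=> qum; have [qm q01] := qum; pose t (i : nat) : R := i%:R / n.+1%:R.
have tS i : t i <= t i.+1 by rewrite /t ler_pM2r ?invr_gt0 // ler_nat.
have q0 v : 0 <= q v by case/andP: (q01 v).
have mq : measurable_fun setT q by apply: nondecreasing_measurable => // x y; exact: qm.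
have t0 : t 0%N = 0 by rewrite /t mul0r.
have t1 : t n.+1 = 1 by rewrite /t divff // pnatr_eq0.
have := integral_steps n.+1 q0 mq t0 tS; rewrite t1 unit_monotone_integral // => e.
have dt i : t i.+1 - t i = n.+1%:R^-1 by rewrite /t -mulrBl -natr1 addrC addKr mul1r.
have lo i : ((q (t i) / n.+1%:R)%:E <= \int[mu]_(v in `[t i, t i.+1[) (q v)%:E)%E.
  rewrite -(dt i) -integral_co_cst //; apply: ge0_le_integral => //=.
  - by move=> v _; rewrite lee_fin.
  - exact: unit_monotone_measurable.
  - by move=> v; rewrite in_itv /= => /andP[tv _]; rewrite lee_fin qm.
have hi i : (\int[mu]_(v in `[t i, t i.+1[) (q v)%:E <= (q (t i.+1) / n.+1%:R)%:E)%E.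
  rewrite -(dt i) -integral_co_cst //; apply: ge0_le_integral => //=.
  - by move=> v _; rewrite lee_fin.
  - exact: unit_monotone_measurable.
  - by move=> v; rewrite in_itv /= => /andP[_ tv]; rewrite lee_fin qm // ltW.
have L : (\sum_(i < n.+1) q (t i)) / n.+1%:R <= mean q.
  by rewrite -lee_fin e mulr_suml -sumEFin; apply: lee_sum => i _; exact: lo.
have U : mean q <= (\sum_(i < n.+1) q (t i.+1)) / n.+1%:R.
  by rewrite -lee_fin e mulr_suml -sumEFin; apply: lee_sum => i _; exact: hi.
have T : \sum_(i < n.+1) q (t i.+1) - \sum_(i < n.+1) q (t i) <= 1.
  rewrite -sumrB -(big_mkord predT (fun i => q (t i.+1) - q (t i))) telescope_sumr //.
  by have /andP[h1 _] := q01 (t 0%N); have /andP[_ h2] := q01 (t n.+1); lra.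
rewrite ger0_norm ?subr_ge0 //.
apply: (@le_trans _ _ ((\sum_(i < n.+1) q (t i.+1) - \sum_(i < n.+1) q (t i)) / n.+1%:R)).
  by rewrite mulrBl lerB.
by rewrite ler_pdivrMr // mulVf ?pnatr_eq0.
Qed.

Lemma mean_cvg (U : Type) (F : set_system U) (FF : Filter F) (q_ : U -> R -> R) q :
    (forall u, unit_monotone (q_ u)) -> unit_monotone q ->
    (forall v, q_ u v @[u --> F] --> q v) ->
  mean (q_ u) @[u --> F] --> mean q.
Proof.
move=> uq_ uq qq; apply/cvgrPdist_le => e e0.
pose n := Num.truncn (3 / e); pose N : R := n.+1%:R.
have N0 : 0 < N by rewrite ltr0n.
have Ne : N^-1 <= e / 3.
  by rewrite -[e / 3]invrK lef_pV2 ?posrE ?invr_gt0 ?divr_gt0 // invf_div ltW // truncnS_gt.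
have : (\sum_(i < n.+1) q_ u (i%:R / N)) / N @[u --> F] --> (\sum_(i < n.+1) q (i%:R / N)) / N.
  by apply: cvgM; [apply: cvg_sumr => i; exact: qq|exact: cvg_cst].
move=> /cvgrPdist_le /(_ (e / 3)) /(_ (divr_gt0 e0 (ltr0n _ 3))).
apply: filterS => u h.
have h1 := mean_riemann n uq; have h2 := mean_riemann n (uq_ u).
move: h h1 h2 Ne; rewrite -/N; set a := _ / N; set b := _ / N; set c := N^-1.
rewrite !ler_norml => /andP[? ?] /andP[? ?] /andP[? ?] ?; apply/andP; split; lra.
Qed.

Lemma powR_unit_monotone q x : 0 < x -> unit_monotone q -> unit_monotone (fun v => q v `^ x).
Proof.
move=> x0 [qm q01]; split=> [u v uv|v].
  have /andP[? ?] := q01 u; have /andP[? ?] := q01 v.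
  by apply: ge0_ler_powR; rewrite ?nnegrE //; [exact: ltW|exact: qm].
have /andP[? ?] := q01 v; rewrite powR_ge0 /=.
have -> : 1 = 1 `^ x :> R by rewrite powR1.
by apply: ge0_ler_powR; rewrite ?nnegrE //; exact: ltW.
Qed.

Lemma cvg_powR (U : Type) (F : set_system U) (FF : Filter F) (u : U -> R) (l x : R) :
  0 < x -> (forall n, 0 <= u n) -> 0 <= l -> u n @[n --> F] --> l ->
  u n `^ x @[n --> F] --> l `^ x.
Proof.
move=> x0 u0; rewrite le_eqVlt => /orP[/eqP <-|l0] ul; last first.
  apply: (@continuous_cvg _ R R F _ u (fun a : R => a `^ x) l) => //.
  apply/differentiable_continuous/derivable1_diffP/derivable_powR.
  by rewrite in_itv /= l0.
rewrite powR0 ?gt_eqF //; apply/cvgrPdist_lt => e e0.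
move/cvgrPdist_lt: ul => /(_ (e `^ x^-1)) /(_ (powR_gt0 _ e0)); apply: filterS => n.
rewrite !sub0r !normrN !ger0_norm ?powR_ge0 // => h.
have -> : e = (e `^ x^-1) `^ x by rewrite -powRrM mulVf ?gt_eqF // powRr1 // ltW.
by apply: gt0_ltr_powR; rewrite ?nnegrE ?powR_ge0.
Qed.

(** Along an ultrafilter finer than [\oo] every [q_ n v] converges, by compactness of the unit
    interval. This replaces the extraction of a subsequence, and [mean_cvg] holds along any
    filter. *)
Lemma helly (q_ : nat -> R -> R) : (forall n, unit_monotone (q_ n)) ->
  exists2 q, unit_monotone q & forall x c, 0 < x ->
    mean (fun v => q_ n v `^ x) @[n --> \oo] --> c -> mean (fun v => q v `^ x) = c.
Proof.
move=> uq; have [G [GU oG]] := @ultraFilterLemma nat \oo _.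
have lim v : exists l : R, q_ n v @[n --> G] --> l.
  have [|l [_ cl]] := @segment_compact R 0 1 (fun A => G ((fun n => q_ n v) @^-1` A)) _.
    by apply: filterE => n; rewrite /= in_itv /=; have [_] := uq n; exact.
  exists l => A Al; have [//|GA] := in_ultra_setVsetC ((fun n => q_ n v) @^-1` A) GU.
  have [w [h1 h2]] := cl (~` A) A GA Al; by case: h1.
have [q qP] := choice lim.
have q01 v : 0 <= q v <= 1.
  apply/andP; split.
    by apply: (cvgr_to_ge (qP v)); apply: filterE => n; have [_ /(_ v)/andP[]] := uq n.
  by apply: (cvgr_to_le (qP v)); apply: filterE => n; have [_ /(_ v)/andP[]] := uq n.
have uqq : unit_monotone q.
  split=> // x y xy; apply: (ler_cvg_to (qP x) (qP y)).
  by apply: filterE => n; have [h _] := uq n; exact: h.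
exists q => // x c x0 qc; apply: (@cvg_unique _ _ (fmap (fun n => mean (fun v => q_ n v `^ x)) G)).
- exact: norm_hausdorff.
- apply: mean_cvg => [n||v]; try exact: powR_unit_monotone.
  apply: cvg_powR => //; first by move=> n; have [_ /(_ v)/andP[]] := uq n.
  by case/andP: (q01 v).
- by move=> A /qc; exact: oG.
Qed.

End UnitMonotone.

(** * The Hausdorff moment problem and Bernstein's theorem *)

Section Hausdorff.
Variable R : realType.
Implicit Types (a : nat -> R).

Fixpoint diffs a (k l : nat) : R :=
  if l is l'.+1 then diffs a k l' - diffs a k.+1 l' else a k.

Definition completely_monotone_seq a := forall k l, 0 <= diffs a k l.

(* Mass that the [n]-th Bernstein approximation of the moment functional puts at [k / n]. *)
Definition bernstein_weight a (n k : nat) : R := 'C(n, k)%:R * diffs a k (n - k).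

Local Notation wt := bernstein_weight.

Lemma diffs_shift a k l : diffs (fun i => a i.+1) k l = diffs a k.+1 l.
Proof. by elim: l k => //= l IHl k; rewrite !IHl. Qed.

(** Induction on [n]: Pascal's rule splits each term, and neighbouring halves recombine by the
    recursion of [diffs]. *)
Lemma sum_bernstein_weight a n : \sum_(k < n.+1) wt a n k = a 0%N.
Proof.
suff S m : \sum_(k < n.+1) 'C(n, k)%:R * diffs a (m + k) (n - k) = a m by exact: (S 0%N).
elim: n m => [|n IHn] m; first by rewrite big_ord_recl big_ord0 /= mul1r !addn0 addr0.
rewrite big_ord_recl /= bin0 addn0 ?subn0.
under eq_bigr do rewrite /bump /= add1n binS natrD mulrDl subSS.
rewrite big_split /= addrA.
have -> : 1 * diffs a m n.+1 + \sum_(i < n.+1) 'C(n, i.+1)%:R * diffs a (m + i.+1) (n - i) =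
    \sum_(i < n.+1) 'C(n, i)%:R * diffs a (m + i) (n.+1 - i).
  transitivity (\sum_(i < n.+2) 'C(n, i)%:R * diffs a (m + i) (n.+1 - i)).
    by rewrite [RHS]big_ord_recl /= bin0 addn0 ?subn0; congr (_ + _); apply: eq_bigr.
  by rewrite big_ord_recr /= bin_small // mul0r addr0.
rewrite -big_split -[RHS](IHn m); apply: eq_bigr => k _ /=.
have kn : (k <= n)%N by rewrite -ltnS.
by rewrite subSn // addnS /=; ring.
Qed.

Definition bernstein_moment a (j n : nat) : R :=
  \sum_(k < n.+1) wt a n k * (k%:R / n%:R) ^+ j.

(** The binomial coefficient absorbs one factor of the node, which lowers [n] and shifts the
    sequence. *)
Lemma bernstein_momentS a j n : bernstein_moment a j.+1 n.+1 =
  \sum_(l < n.+1) wt (fun i => a i.+1) n l * (l.+1%:R / n.+1%:R) ^+ j.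
Proof.
rewrite /bernstein_moment big_ord_recl mul0r expr0n mulr0 add0r.
apply: eq_bigr => l _; rewrite lift0 /wt diffs_shift subSS exprS.
have -> : 'C(n, l)%:R = 'C(n.+1, l.+1)%:R * (l.+1%:R / n.+1%:R) :> R.
  have n0 : n.+1%:R != 0 :> R by rewrite pnatr_eq0.
  by apply: (mulfI n0); rewrite -natrM mul_bin_diag natrM; field.
ring.
Qed.

Lemma exprB_le (x y : R) j : 0 <= y -> y <= x -> x <= 1 -> x ^+ j - y ^+ j <= j%:R * (x - y).
Proof.
move=> y0 yx x1; elim: j => [|j IHj]; first by rewrite !expr0 subrr mul0r.
rewrite !exprS -natr1 mulrDl mul1r.
have -> : x * x ^+ j - y * y ^+ j = x * (x ^+ j - y ^+ j) + (x - y) * y ^+ j by ring.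
have x0 : 0 <= x by exact: le_trans yx.
have d0 : 0 <= x ^+ j - y ^+ j by rewrite subr_ge0 lerXn2r ?nnegrE.
have yj : y ^+ j <= 1 by rewrite exprn_ile1 // (le_trans yx).
apply: lerD; first by apply: le_trans IHj; rewrite ler_piMl.
by rewrite ler_piMr // subr_ge0.
Qed.

(** Induction on [j]: after the shift, replacing the nodes [(l + 1) / (n + 1)] by [l / n] costs at
    most [j / (n + 1)] times the total mass. *)
Lemma bernstein_moment_cvg a j : completely_monotone_seq a ->
  bernstein_moment a j n @[n --> \oo] --> a j.
Proof.
elim: j a => [|j IHj] a cm.
  rewrite (_ : (fun n => _) = fun=> a 0%N); first exact: cvg_cst.
  apply/funext => n; rewrite -[RHS](sum_bernstein_weight a n).
  by apply: eq_bigr => k _; rewrite expr0 mulr1.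
rewrite -(cvg_shiftn 1); under eq_fun do rewrite addn1.
pose b i := a i.+1.
have cmb : completely_monotone_seq b by move=> k l; rewrite diffs_shift.
have w0 n l : 0 <= wt b n l by rewrite mulr_ge0.
pose e (n : nat) : R := b 0%N * (j%:R * n.+1%:R^-1).
have e0 : e @ \oo --> (0 : R).
  rewrite -(mulr0 (b 0%N)) -(mulr0 (j%:R : R)).
  apply: cvgM; first exact: cvg_cst.
  apply: cvgM; first exact: cvg_cst.
  exact: cvg_harmonic.
have bnd n : (0 < n)%N ->
    `|bernstein_moment a j.+1 n.+1 - bernstein_moment b j n| <= e n.
  move=> n0; have nr : 0 < n%:R :> R by rewrite ltr0n.
  rewrite bernstein_momentS /bernstein_moment -sumrB.
  apply: (le_trans (ler_norm_sum _ _ _)).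
  rewrite /e -(sum_bernstein_weight b n) mulr_suml; apply: ler_sum => l _.
  rewrite -mulrBr normrM (ger0_norm (w0 n l)) ler_wpM2l //.
  have ln : l%:R <= n%:R :> R by rewrite ler_nat -ltnS.
  pose x : R := l.+1%:R / n.+1%:R; pose y : R := l%:R / n%:R.
  have y0 : 0 <= y by rewrite divr_ge0.
  have xy : x - y = (n%:R - l%:R) / (n%:R * n.+1%:R).
    have n1 : n%:R + 1 != 0 :> R by rewrite natr1 pnatr_eq0.
    by rewrite /x /y -(natr1 l) -(natr1 n); field; rewrite n1 gt_eqF.
  have yx : y <= x by rewrite -subr_ge0 xy divr_ge0 ?subr_ge0 ?mulr_ge0.
  have x1 : x <= 1 by rewrite ler_pdivrMr ?ltr0n // mul1r ler_nat ltnS -ltnS.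
  rewrite ger0_norm ?subr_ge0 ?lerXn2r ?nnegrE ?(le_trans y0) //.
  apply: (le_trans (exprB_le j y0 yx x1)); rewrite ler_wpM2l // xy.
  by rewrite invfM mulrA ler_piMl ?invr_ge0 // ler_pdivrMr // mul1r lerBlDr lerDl.
apply/cvgrPdist_le => eps eps0.
have := IHj b cmb => /cvgrPdist_le /(_ (eps / 2)) /(_ (divr_gt0 eps0 (ltr0n _ 2))).
move: e0 => /cvgrPdist_le /(_ (eps / 2)) /(_ (divr_gt0 eps0 (ltr0n _ 2))) e0 h.
near=> n.
have h1 : `|b j - bernstein_moment b j n| <= eps / 2 by near: n.
have h2 : `|0 - e n| <= eps / 2 by near: n.
have h3 : `|bernstein_moment a j.+1 n.+1 - bernstein_moment b j n| <= e n.
  by apply: bnd; near: n; exact: nbhs_infty_gt.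
move: h1 h2 h3; rewrite /b /=; set u := bernstein_moment a _ _; set v := bernstein_moment _ _ _.
rewrite !ler_norml => /andP[? ?] /andP[? ?] /andP[? ?]. apply/andP; split; lra.
Unshelve. all: by end_near. Qed.

Lemma step_quantile (w : nat -> R) (N : nat) : (0 < N)%N -> (forall k, 0 <= w k) ->
    0 < \sum_(k < N.+1) w k ->
  exists2 q, unit_monotone q & forall j : nat,
    mean (fun v => q v ^+ j) =
    (\sum_(k < N.+1) w k * (k%:R / N%:R) ^+ j) / \sum_(k < N.+1) w k.
Proof.
move=> N0 w0; set M := \sum_(k < N.+1) w k => M0.
have Nr : 0 < N%:R :> R by rewrite ltr0n.
pose W k := \sum_(i < k) w i.
have WS k : W k.+1 = W k + w k by rewrite /W big_ord_recr.
have Wnd i j : (i <= j)%N -> W i <= W j.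
  by move=> /subnKC <-; elim: (j - i)%N => [|k IHk]; rewrite ?addn0 // addnS WS; rewrite (le_trans IHk) // lerDl.
(* The quantile function of the measure with mass [w k / M] at [k / N]: it counts the cumulative
   sums that [M * v] has reached. *)
pose q v : R := (\sum_(k < N) (W k.+1 <= M * v)%R%:R) / N%:R.
have uq : unit_monotone q.
  split=> [x y xy|v].
    rewrite ler_pM2r ?invr_gt0 //; apply: ler_sum => k _; rewrite ler_nat.
    case: leP => // Wx; case: leP => // yW; have := lt_le_trans yW Wx.
    by rewrite ltr_pM2l // ltNge xy.
  rewrite divr_ge0 ?sumr_ge0 //= ler_pdivrMr // mul1r.
  apply: (@le_trans _ _ (\sum_(k < N) 1)); last by rewrite sumr_const card_ord.
  by apply: ler_sum => k _; rewrite (ler_nat R _ 1) leq_b1.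
exists q => // j.
have [qm q01] := uq.
pose g v := q v ^+ j.
have g0 v : 0 <= g v by rewrite exprn_ge0 //; case/andP: (q01 v).
have mg : measurable_fun setT g.
  apply: nondecreasing_measurable => // x y xy.
  by rewrite /g lerXn2r ?nnegrE ?qm //; [case/andP: (q01 x)|case/andP: (q01 y)].
pose t k := W k / M.
have t0 : t 0%N = 0 by rewrite /t /W big_ord0 mul0r.
have tS k : t k <= t k.+1 by rewrite ler_pM2r ?invr_gt0 // Wnd.
have t1 : t N.+1 = 1 by rewrite /t divff // gt_eqF.
rewrite /mean; have := integral_steps N.+1 g0 mg t0 tS; rewrite t1 => ->.
rewrite (eq_bigr (fun k : 'I_N.+1 => ((k%:R / N%:R) ^+ j * (w k / M))%:E)).
  by rewrite sumEFin /= mulr_suml; apply: eq_bigr => k _; ring.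
move=> k _; have -> : w k / M = t k.+1 - t k by rewrite /t -mulrBl WS addrC addKr.
rewrite -integral_co_cst //; apply: eq_integral => v; rewrite inE /= in_itv /= => /andP[v1 v2].
congr ((_ ^+ j)%:E); rewrite /q; congr (_ / _).
have e (i : 'I_N) : (W i.+1 <= M * v) = (i < k)%N.
  have [ik|ki] := ltnP i k.
    by apply: (le_trans (Wnd _ _ ik)); rewrite mulrC -ler_pdivrMr.
  apply/negbTE; rewrite -ltNge; apply: lt_le_trans (Wnd k.+1 i.+1 ki).
  by rewrite mulrC -ltr_pdivlMr.
under eq_bigr do rewrite e.
rewrite -natr_sum; congr _%:R.
rewrite -(big_mkord predT (fun i => (i < k)%N : nat)) /= (big_cat_nat (n := k)) //=; last by rewrite -ltnS.
rewrite [X in (_ + X)%N]big1_seq ?addn0; last first.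
  by move=> i /=; rewrite mem_index_iota => /andP[ki _]; rewrite ltnNge ki.
rewrite big_nat (eq_bigr (fun=> 1%N)) -?big_nat ?sum_nat_const_nat ?subn0 ?muln1 //.
by move=> i /andP[_ ->].
Qed.

(** The Bernstein weights are discrete measures of mass [a 0]; [helly] gives a limit of their
    quantile functions, and its moments are the limits of the Bernstein moments. *)
Theorem hausdorff_moment a : completely_monotone_seq a ->
  exists2 q, unit_monotone q & forall j, (0 < j)%N -> a 0%N * mean (fun v => q v ^+ j) = a j.
Proof.
move=> cm; have a0 j : 0 <= a j by exact: (cm j 0%N).
have an j : a j <= a 0%N.
  elim: j => // j; apply: le_trans; rewrite -subr_ge0; exact: (cm j 1%N).
have [a00|a00] := eqVneq (a 0%N) 0.
  exists (fun=> 0); first by split=> // v; rewrite lexx ler01.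
  move=> j _; apply/eqP; rewrite a00 mul0r eq_le a0 /= -a00 //.
have ap : 0 < a 0%N by rewrite lt_def a00 a0.
have w0 n k : 0 <= wt a n k by rewrite mulr_ge0.
have ex n : exists q : R -> R, unit_monotone q /\
    forall j, mean (fun v => q v ^+ j) = bernstein_moment a j n.+1 / a 0%N.
  have [|q uq qE] := @step_quantile (wt a n.+1) n.+1 (ltn0Sn n) (w0 _).
    by rewrite sum_bernstein_weight.
  by exists q; split => // j; rewrite qE sum_bernstein_weight.
have [q_ qP] := choice ex.
have [q uq qE] := helly (fun n => (qP n).1).
have pw n j v : q_ n v `^ j%:R = q_ n v ^+ j.
  by rewrite powR_mulrn //; have [[_ /(_ v)/andP[]]] := qP n.
exists q => // j j0; have jr : 0 < j%:R :> R by rewrite ltr0n.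
have := qE j%:R (a j / a 0%N) jr.
have -> : (fun v => q v `^ j%:R) = (fun v => q v ^+ j).
  by apply/funext => v; rewrite powR_mulrn //; have [_ /(_ v)/andP[]] := uq.
move=> -> //; first by rewrite mulrC divfK.
rewrite (_ : (fun n => _) = (fun n => bernstein_moment a j n.+1 / a 0%N)); last first.
  apply/funext => n; rewrite -(qP n).2; congr mean; apply/funext => v; exact: pw.
apply: cvgM; last exact: cvg_cst.
by have := @bernstein_moment_cvg a j cm; rewrite -(cvg_shiftn 1); under eq_fun do rewrite addn1.
Qed.

End Hausdorff.

Section Bernstein.
Variable R : realType.
Implicit Types H : R -> R.

Definition decrement (h : R) H (x : R) := H x - H (x + h).

(** Each point [y i] is doubled into [y i] and [y i + h] with opposite signs. *)
Lemma hankel_psd_decrement2 H h : 0 <= h -> hankel_psd H ->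
  hankel_psd (decrement h (decrement h H)).
Proof.
move=> h0 hH T y y0 c.
pose y' (p : T * bool) := y p.1 + if p.2 then 0 else h.
pose c' (p : T * bool) := c p.1 * if p.2 then 1 else -1.
have y'0 p : 0 <= y' p by rewrite addr_ge0 //; case: p.2.
have := hH _ y' y'0 c'; congr (_ <= _).
rewrite /qform -(pair_bigA _ (fun i s => \sum_q c' (i, s) * c' q * H (y' (i, s) + y' q))) /=.
apply: eq_bigr => i _; rewrite big_bool /=.
rewrite -(pair_bigA _ (fun j s => c' (i, true) * c' (j, s) * H (y' (i, true) + y' (j, s)))) /=.
rewrite -(pair_bigA _ (fun j s => c' (i, false) * c' (j, s) * H (y' (i, false) + y' (j, s)))) /=.
rewrite -big_split; apply: eq_bigr => j _ /=.
rewrite !big_bool /c' /y' /decrement /= !addr0.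
rewrite [y i + (y j + h)]addrA [y i + h + y j]addrAC [y i + h + (y j + h)]addrACA !addrA.
by ring.
Qed.

Definition bounded_hankel H := hankel_psd H /\ exists B, forall x, 0 <= x -> `|H x| <= B.

Lemma bounded_hankel_decrement2 H h : 0 <= h -> bounded_hankel H ->
  bounded_hankel (decrement h (decrement h H)).
Proof.
move=> h0 [hH [B HB]]; split; first exact: hankel_psd_decrement2.
exists (4 * B) => x x0; rewrite /decrement.
have h1 := HB _ x0; have h2 := HB _ (addr_ge0 x0 h0).
have h3 := HB _ (addr_ge0 (addr_ge0 x0 h0) h0).
move: h1 h2 h3; rewrite !ler_norml => /andP[? ?] /andP[? ?] /andP[? ?].
by apply/andP; split; lra.
Qed.

(* The second differences of [H] along a grid are nonnegative, so a negative first difference would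
   make the convex sequence of the values of [H] unbounded. *)
Lemma bounded_hankel_decrement_ge0 H h x : 0 <= h -> 0 <= x -> bounded_hankel H ->
  0 <= decrement h H x.
Proof.
move=> h0 x0 bH; have [hH [B HB]] := bH.
pose G (k : nat) := - H (x + k%:R * h).
have p0 (k : nat) : 0 <= x + k%:R * h by rewrite addr_ge0 ?mulr_ge0.
have Gc k : G k + G k.+2 <= 2 * G k.+1.
  have := hankel_psd_ge0 (hankel_psd_decrement2 h0 hH) (p0 k).
  rewrite /decrement /G.
  have -> : x + k%:R * h + h = x + k.+1%:R * h by rewrite -natr1; ring.
  have -> : x + k.+1%:R * h + h = x + k.+2%:R * h by rewrite -(natr1 k.+1); ring.
  lra.
have Gn n : G n - G 0%N <= n%:R * (G 1%N - G 0%N).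
  elim: n => [|n IHn]; first by rewrite mul0r subrr.
  by have := concave_seq_incr Gc 0 n; rewrite addn0 -natr1 mulrDl mul1r; lra.
rewrite /decrement -oppr_le0 opprB.
have -> : H (x + h) - H x = - (G 1%N - G 0%N) by rewrite /G mul1r mul0r addr0; lra.
apply: (@archi_le0 _ _ (2 * B)) => n; have := Gn n.+1.
have := HB _ (p0 n.+1); have := HB _ (p0 0%N).
rewrite -/(G _) !ler_norml /G => /andP[? ?] /andP[? ?]; lra.
Qed.

(** The induction carries two consecutive orders for all [H] at once, since the step within the
    class of bounded Hankel functions is the second difference. *)
Lemma iter_decrement_ge0 H h x l : 0 <= h -> 0 <= x -> bounded_hankel H ->
  0 <= iter l (decrement h) H x.
Proof.
move=> h0 x0; suff S : forall H, bounded_hankel H ->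
    0 <= iter l (decrement h) H x /\ 0 <= iter l.+1 (decrement h) H x.
  by move=> /S[].
elim: l => [|l IHl] {}H bH; first by split; [case: bH => hH _; exact: hankel_psd_ge0|exact: bounded_hankel_decrement_ge0].
split; first by have [] := IHl _ bH.
by have [h1 _] := IHl _ (bounded_hankel_decrement2 h0 bH); rewrite !iterSr.
Qed.

Lemma diffs_decrement H h k l :
  diffs (fun k => H (k%:R * h)) k l = iter l (decrement h) H (k%:R * h).
Proof.
elim: l k => //= l IHl k; rewrite !IHl /decrement.
by have -> : k.+1%:R * h = k%:R * h + h by rewrite -natr1 mulrDl mul1r.
Qed.

Variable H : R -> R.
Hypothesis hH : hankel_psd H.
Hypothesis Hni : forall x y, 0 <= x -> x <= y -> H y <= H x.

Let H0 x : 0 <= x -> 0 <= H x.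
Proof. exact: hankel_psd_ge0. Qed.

Let bH : bounded_hankel H.
Proof.
by split => //; exists (H 0) => x x0; rewrite ger0_norm ?H0 // Hni.
Qed.

Let grid (h : R) : 0 <= h -> exists q : R -> R, unit_monotone q /\
  forall k, (0 < k)%N -> H 0 * mean (fun v => q v ^+ k) = H (k%:R * h).
Proof.
move=> h0; have [|q uq qE] := @hausdorff_moment R (fun k => H (k%:R * h)).
  by move=> k l; rewrite diffs_decrement iter_decrement_ge0 // mulr_ge0.
by exists q; split => // k k0; rewrite -qE // mul0r.
Qed.

(** [- H] is nondecreasing and midpoint concave, so [midconcave_local] yields a modulus of
    continuity at positive points. *)
Let decr_local x d n : 0 <= d -> n%:R * d <= x -> n%:R * (H x - H (x + d)) <= H 0.
Proof.
move=> d0 nd; have x0 : 0 <= x by apply: le_trans nd; rewrite mulr_ge0.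
have nd' u v : 0 <= u -> u <= v -> - H u <= - H v by move=> u0 uv; rewrite lerN2 Hni.
have mc u e : 0 <= u -> 0 <= e -> - H u + - H (u + 2 * e) <= 2 * - H (u + e).
  move=> u0 e0; have := hankel_psd_ge0 (hankel_psd_decrement2 e0 hH) u0.
  rewrite /decrement (_ : u + e + e = u + 2 * e); last by ring.
  lra.
have := midconcave_local nd' mc d0 nd.
by have := H0 x0; rewrite !opprK; lra.
Qed.

Theorem bernstein_quantile : exists2 q, unit_monotone q &
  forall x, 0 < x -> H 0 * mean (fun v => q v `^ x) = H x.
Proof.
have [H00|H00] := eqVneq (H 0) 0.
  exists (fun=> 0); first by split=> // v; rewrite lexx ler01.
  move=> x x0; rewrite H00 mul0r; apply/esym/eqP; rewrite eq_le; apply/andP; split.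
    by rewrite -H00; apply: Hni => //; exact: ltW.
  by apply: H0; exact: ltW.
have H0p : 0 < H 0 by rewrite lt_def H00 H0.
pose h (m : nat) : R := (2^-1) ^+ m.
have h0 m : 0 < h m by rewrite exprn_gt0 // invr_gt0.
have [q_ qP] := choice (fun m => grid (ltW (h0 m))).
(* The moments of [q_ m] sit at multiples of the grid step [h m]; the power [2 ^+ m] brings them
   back to their true arguments. *)
pose p m v := q_ m v `^ (2 ^+ m).
have up m : unit_monotone (p m) by apply: powR_unit_monotone; [rewrite exprn_gt0|case: (qP m)].
have [q uq qE] := helly up; have [qm q01] := uq.
(* At a dyadic argument all grids from the [m]-th on agree, so the sequence given to [helly] is
   eventually constant. *)
have dyadic k m : (0 < k)%N -> H 0 * mean (fun v => q v `^ (k%:R * h m)) = H (k%:R * h m).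
  move=> k0; rewrite (qE _ (H (k%:R * h m) / H 0)) ?mulr_gt0 ?ltr0n //; first by rewrite mulrC divfK.
  rewrite -(cvg_shiftn m); apply: cvg_near_cst; apply: nearW => n /=.
  rewrite -[LHS](mulfK H00); congr (_ / _).
  have e : k%:R * h m = (k * 2 ^ n)%:R * h (n + m)%N.
    by rewrite natrM natrX /h exprD -mulrA [2 ^+ n * _]mulrA -exprMn divff ?pnatr_eq0 // expr1n mul1r.
  rewrite [in RHS]e -(qP (n + m)%N).2 ?muln_gt0 ?k0 ?expn_gt0 // [LHS]mulrC; congr (_ * mean _).
  apply/funext => v; rewrite /p -powRrM -[RHS]powR_mulrn; last by have [[_ /(_ v)/andP[]]] := qP (n + m)%N.
  congr (_ `^ _); rewrite e mulrCA /h -exprMn divff ?pnatr_eq0 // expr1n mulr1.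
  by [].
have meanni x y : 0 < x -> x <= y -> mean (fun v => q v `^ y) <= mean (fun v => q v `^ x).
  move=> x0 xy; have y0 := lt_le_trans x0 xy.
  rewrite -lee_fin -!unit_monotone_integral; try exact: powR_unit_monotone.
  apply: ge0_le_integral => //=.
  - by move=> v _; rewrite lee_fin powR_ge0.
  - by apply: unit_monotone_measurable => //; exact: powR_unit_monotone.
  - by apply: unit_monotone_measurable => //; exact: powR_unit_monotone.
  move=> v _; rewrite lee_fin; have /andP[] := q01 v; rewrite le_eqVlt => /orP[/eqP <-|v0] v1.
    by rewrite !powR0 ?gt_eqF.
  by apply: ger_powR => //; rewrite v0 v1.
exists q => // x x0.
set A := H 0 * _; suff bnd (n : nat) : `|A - H x| * n.+1%:R <= H 0.
  by apply/eqP; rewrite -subr_eq0 -normr_le0; exact: archi_le0 bnd.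
(* At least [n.+1] steps of this grid fit below [x], so [decr_local] bounds the variation of [H]
   over the cell of [x] by [H 0 / n.+1]; both sides are monotone and agree at the ends of the
   cell. *)
pose m := Num.truncn (n.+1%:R / x).
have m2 : n.+1%:R / x < 2 ^+ m.
  apply: (@lt_le_trans _ _ m.+1%:R); first exact: truncnS_gt.
  by rewrite -natrX ler_nat ltn_expl.
have hm : h m * n.+1%:R <= x.
  rewrite /h exprVn mulrC ler_pdivrMr ?exprn_gt0 //.
  by move: m2; rewrite ltr_pdivrMr // mulrC => /ltW.
pose k := Num.truncn (x / h m).
have /andP[kl ku] : k%:R <= x / h m < k.+1%:R by apply: truncn_itv; rewrite divr_ge0 ?ltW.
have kn : (n < k)%N.
  by rewrite truncn_ge_nat ?divr_ge0 ?(ltW x0) ?(ltW (h0 m)) // ler_pdivlMr // mulrC.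
move: kl ku; rewrite ler_pdivlMr // ltr_pdivrMr // => kl ku.
have kp : 0 < k%:R * h m by rewrite mulr_gt0 // ltr0n; exact: leq_trans kn.
have A1 : A <= H (k%:R * h m) by rewrite -dyadic ?(leq_trans _ kn) // ler_pM2l // meanni.
have A2 : H (k.+1%:R * h m) <= A by rewrite -dyadic // ler_pM2l // meanni // ltW.
have B1 : H x <= H (k%:R * h m) by rewrite Hni // ltW.
have B2 : H (k.+1%:R * h m) <= H x by rewrite Hni // ltW.
have d : k%:R * (H (k%:R * h m) - H (k%:R * h m + h m)) <= H 0 by apply: decr_local => //; exact: ltW.
rewrite -natr1 mulrDl mul1r in A2 B2.
have ab : `|A - H x| <= H (k%:R * h m) - H (k%:R * h m + h m).
  by rewrite ler_norml; apply/andP; split; lra.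
apply: le_trans d; rewrite mulrC; by apply: ler_pM => //; rewrite ler_nat.
Qed.

End Bernstein.

(** * The representing measure *)

Section QuantileMeasure.
Variable R : realType.
Notation mu := (@lebesgue_measure R).
Notation pos := (`]0, +oo[%classic : set (measurableTypeR R)).

(** An additive form of inner regularity, which passes to finite sums of measures by uniting the
    compact sets. *)
Definition inner_approx (nu : set (measurableTypeR R) -> \bar R) (B : set (measurableTypeR R)) :=
  forall e : R, 0 < e -> exists K : set R, [/\ compact K, K `<=` B & (nu B <= nu K + e%:E)%E].

Variables (q : R -> R) (M : R).
Hypotheses (uq : unit_monotone q) (M0 : 0 <= M).

(* On the unit interval [q v = expR (- s v)] when [q v] is positive; as [ln 0 = 0], the points where
   [q] vanishes are sent, like those where [q v = 1], outside of the open half line. *)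
Definition log_quantile (v : R) : R := - ln (q v) * \1_(`[0, 1[%classic) v.

Local Notation s := log_quantile.

Lemma measurable_log_quantile :
  measurable_fun setT (s : measurableTypeR R -> measurableTypeR R).
Proof.
apply: measurable_funM; last exact: measurable_indic.
apply: measurableT_comp => //; apply: measurableT_comp; first exact: measurable_ln.
by apply: nondecreasing_measurable => // x y; case: uq => + _; apply.
Qed.

Lemma log_quantile_preimage (B : set R) : B `<=` pos -> s @^-1` B `<=` `[0, 1[.
Proof.
move=> Bp v /= /Bp; rewrite /= in_itv /= andbT /s indicE.
by case: (boolP (v \in `[0, 1[%classic)) => [|_]; [rewrite inE|rewrite mulr0 ltxx].
Qed.

Lemma log_quantile_pos : s @^-1` pos = [set v | (v \in `[0, 1[) /\ (0 < q v < 1)].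
Proof.
apply/seteqP; split=> v /=.
  move=> h; have v01 : v \in `[0, 1[ := @log_quantile_preimage pos (fun x => id) v h.
  split=> //; move: h; rewrite in_itv /= andbT /s indicE mem_set // mulr1 oppr_gt0.
  have [_ /(_ v)/andP[q0 q1]] := uq.
  move: q0; rewrite le_eqVlt => /orP[/eqP <-|q0]; first by rewrite ln0 // ltxx.
  by rewrite q0 -{1}ln1 ltr_ln ?posrE.
move=> [v01 q01]; rewrite in_itv /= andbT /s indicE mem_set // mulr1 oppr_gt0.
exact: ln_lt0.
Qed.

Let mpos : measurable pos. Proof. exact: measurable_itv. Qed.

Definition quantile_push : {measure set (measurableTypeR R) -> \bar R}.
Proof.
unshelve refine (pushforward mu (s : measurableTypeR R -> measurableTypeR R) : {measure set (measurableTypeR R) -> \bar R}).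
exact: measurable_log_quantile.
Defined.

Definition quantile_measure : {measure set (measurableTypeR R) -> \bar R} :=
  mscale (NngNum M0) (mrestr quantile_push mpos).

Lemma quantile_measureE B : quantile_measure B = (M%:E * mu (s @^-1` (B `&` pos)))%E.
Proof. by []. Qed.

Lemma quantile_measure_compl : quantile_measure (~` pos) = 0%E.
Proof. by rewrite quantile_measureE setICl preimage_set0 measure0 mule0. Qed.

Let ms (B : set (measurableTypeR R)) : measurable B -> measurable (s @^-1` B).
Proof. by move=> mB; rewrite -[X in measurable X]setTI; exact: measurable_log_quantile. Qed.

(** By Lusin's theorem [log_quantile] is continuous on a compact subset of nearly full measure in
    the preimage of [B]; the image of that subset is compact. *)
Lemma quantile_measure_inner (B : set (measurableTypeR R)) : measurable B -> B `<=` pos ->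
  inner_approx quantile_measure B.
Proof.
move=> mB Bp e e0; pose A := s @^-1` B.
have mA : measurable A by exact: ms.
have A01 : A `<=` `[0, 1[ by exact: log_quantile_preimage.
have finA : (mu A < +oo)%E.
  apply: (@le_lt_trans _ _ (mu `[0%R, 1%R[)); first by apply: le_measure; rewrite ?inE.
  by rewrite lebesgue_measure_itv /= lte_fin ltr01 -EFinD ltry.
(* Dividing by [M + 1] also covers [M = 0]. *)
have e10 : 0 < e / (M + 1) by rewrite divr_gt0 // ltr_wpDl.
have [K [cK KA muK cs]] := measurable_almost_continuous mA finA e10
  (measurable_funS measurableT (@subsetT _ _) measurable_log_quantile).
have mK : measurable K by apply: closed_measurable; apply: compact_closed => //; exact: Rhausdorff.
have cK' : compact (s @` K) by exact: continuous_compact.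
have mK' : measurable (s @` K : set R).
  by apply: closed_measurable; apply: compact_closed => //; exact: Rhausdorff.
exists (s @` K); split => //; first by move=> _ [v Kv <-]; exact: KA.
rewrite !quantile_measureE (setIidl Bp) setIidl; last by move=> _ [v Kv <-]; apply/Bp/KA.
have le1 : (mu A <= mu (s @^-1` (s @` K)) + (e / (M + 1))%:E)%E.
  rewrite -(setDUK KA); apply: (le_trans (measureU2 _ _ _)) => //; first exact: measurableD.
  apply: leeD; last exact: ltW.
  by apply: le_measure; rewrite ?inE //; [exact: ms|exact: preimage_image].
apply: (@le_trans _ _ (M%:E * (mu (s @^-1` (s @` K)) + (e / (M + 1))%:E))%E).
  by apply: lee_wpmul2l.
rewrite ge0_muleDr //; last by rewrite lee_fin ltW.
rewrite leeD2l // -EFinM lee_fin mulrCA ger_pMr // ler_pdivrMr ?mul1r ?ltr_wpDl //.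
by rewrite lerDl.
Qed.

Let Z : set R := [set v | (v \in `[0, 1[) /\ (q v = 0)].

Let mq : measurable_fun setT q.
Proof. by apply: nondecreasing_measurable => // x y; case: uq => + _; apply. Qed.

Let mZ : measurable Z.
Proof.
have -> : Z = `[0, 1[ `&` q @^-1` [set 0] by apply/seteqP; split.
by apply: measurableI => //; rewrite -[X in measurable X]setTI; apply: mq.
Qed.

Let P : set R := s @^-1` pos.

Let mP : measurable P. Proof. exact: ms. Qed.

Let dZP : [disjoint Z & P].
Proof.
apply/disj_setPS => v [[_ qv]]; rewrite /P log_quantile_pos /= => -[_].
by rewrite qv ltxx.
Qed.

Let ZP01 : Z `|` P `<=` `[0, 1[.
Proof. by move=> v [[]//|]; rewrite /P log_quantile_pos /= => -[]. Qed.

Let ZP1 : (mu Z + mu P <= 1)%E.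
Proof.
rewrite -measureU //; last exact/eqP.
apply: (@le_trans _ _ (mu `[0%R, 1%R[)).
  by apply: le_measure; rewrite ?inE //; exact: measurableU.
by rewrite lebesgue_measure_itv /= lte_fin ltr01 -EFinD subr0.
Qed.

Let fZ : (mu Z)%E = (fine (mu Z))%:E.
Proof.
rewrite fineK // ge0_fin_numE //; apply: le_lt_trans (ltry 1).
by apply: le_trans ZP1; rewrite leeDl.
Qed.

(** The mass at infinite exponent: where [q] vanishes the integrand is [1] for every positive
    [x]. *)
Definition quantile_atom : R := M * fine (mu Z).

Lemma quantile_atom_ge0 : 0 <= quantile_atom.
Proof. by rewrite mulr_ge0 // fine_ge0. Qed.

Lemma quantile_measure_mass : (quantile_atom%:E + quantile_measure pos <= M%:E)%E.
Proof.
rewrite quantile_measureE setIid EFinM -fZ -ge0_muleDr // -[leRHS]mule1.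
exact: lee_wpmul2l.
Qed.

(** The unit interval splits into the zeros of [q], the set [P] pushed to the open half line, and
    the set where [q = 1] and the integrand vanishes. *)
Lemma quantile_measure_integral x : 0 < x ->
  (quantile_atom%:E + \int[quantile_measure]_(u in pos) (1 - expR (- (x * u)))%:E =
   (M - M * mean (fun v => q v `^ x))%:E)%E.
Proof.
move=> x0; have uqx := powR_unit_monotone x0 uq; have [qxm qx01] := uqx.
have qx0 v : 0 <= q v `^ x by exact: powR_ge0.
have qx1 v : q v `^ x <= 1 by case/andP: (qx01 v).
have mg (D : set R) : measurable D -> measurable_fun D (fun v => (1 - q v `^ x)%:E).
  move=> mD; apply/measurable_EFinP; apply: measurable_funB => //.
  by apply: nondecreasing_measurable => // u v; exact: qxm.
have f0 u : pos u -> 0 <= 1 - expR (- (x * u)).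
  by rewrite /= in_itv /= andbT => u0; rewrite subr_ge0 expR_le1 oppr_le0 mulr_ge0 // ltW.
have mf (D : set (measurableTypeR R)) : measurable D ->
    measurable_fun D (fun u : measurableTypeR R => (1 - expR (- (x * u)))%:E).
  move=> mD; apply/measurable_EFinP; apply: nondecreasing_measurable => // u v uv.
  by rewrite lerD2l lerN2 ler_expR lerN2 ler_pM2l.
have -> : (\int[quantile_measure]_(u in pos) (1 - expR (- (x * u)))%:E =
    M%:E * \int[mu]_(v in P) (1 - q v `^ x)%:E)%E.
  rewrite (ge0_integral_mscale _ mpos (NngNum M0) (mf _ mpos)); last by move=> u /f0; rewrite lee_fin.
  congr (_ * _)%E.
  transitivity (\int[quantile_push]_(u in pos) (1 - expR (- (x * u)))%:E)%E.
    apply: eq_measure_integral => A mA Ap; rewrite /= /mrestr setIidl //.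
  rewrite ge0_integral_pushforward //=; [|exact: measurable_log_quantile|exact: mf|].
  - apply: eq_integral => v; rewrite inE log_quantile_pos /= => -[v01 /andP[qv0 _]].
    rewrite /s indicE mem_set // mulr1 mulrN opprK mulrC /powR gt_eqF //.
    by rewrite mulrC.
  - by move=> u; rewrite inE => /f0; rewrite lee_fin.
have -> : (quantile_atom%:E = M%:E * \int[mu]_(v in Z) (1 - q v `^ x)%:E)%E.
  rewrite /quantile_atom EFinM -fZ -[mu Z]mul1e -(integral_cst mu mZ 1%E).
  congr (_ * _)%E; apply: eq_integral => v; rewrite inE => -[_ qv].
  by rewrite qv powR0 ?gt_eqF // subr0.
rewrite -ge0_muleDr; try by apply: integral_ge0 => v _; rewrite lee_fin subr_ge0.
rewrite -ge0_integral_setU //; last 2 first.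
- by apply: mg; exact: measurableU.
- by move=> v _; rewrite lee_fin subr_ge0.
have -> : (\int[mu]_(v in Z `|` P) (1 - q v `^ x)%:E = \int[mu]_(v in `[0%R, 1%R[) (1 - q v `^ x)%:E)%E.
  rewrite [LHS]integral_mkcond [RHS]integral_mkcond.
  apply: eq_integral => v _; rewrite /patch; case: ifPn => [|vn].
    by rewrite inE => /ZP01 v01; rewrite mem_set.
  case: ifPn => //; rewrite inE => v01; have [_ /(_ v)/andP[q0 q1]] := uq.
  suff -> : q v = 1 by rewrite powR1 subrr.
  move: vn; rewrite notin_setE => vn; apply/eqP; rewrite eq_le q1 leNgt; apply/negP => q1'.
  apply: vn; move: q0; rewrite le_eqVlt => /orP[/eqP qv|qv]; [left|right] => //.
  by rewrite /P log_quantile_pos; split => //; rewrite qv q1'.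
have e1 : (\int[mu]_(v in `[0%R, 1%R[) (1 - q v `^ x)%:E + (mean (fun v => q v `^ x))%:E = 1)%E.
  rewrite -unit_monotone_integral // -ge0_integralD //; last 4 first.
  - by move=> v _; rewrite lee_fin subr_ge0.
  - exact: mg.
  - by move=> v _; rewrite lee_fin.
  - exact: unit_monotone_measurable.
  rewrite -[RHS](_ : (1 * (1 - 0))%:E = _); last by rewrite subr0 mulr1.
  rewrite -integral_co_cst //; apply: eq_integral => v _.
  by rewrite -EFinD subrK.
have -> : (\int[mu]_(v in `[0%R, 1%R[) (1 - q v `^ x)%:E = (1 - mean (fun v => q v `^ x))%:E)%E.
  by rewrite EFinB -e1 addeK.
by rewrite -EFinM mulrBr mulr1.
Qed.

End QuantileMeasure.

(** * The representation of a preserver *)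

Section Representation.
Variable R : realType.
Notation pos := (`]0, +oo[%classic : set (measurableTypeR R)).

Lemma bernstein_measure (H : R -> R) : hankel_psd H ->
    (forall x y, 0 <= x -> x <= y -> H y <= H x) ->
  exists p : R * {measure set (measurableTypeR R) -> \bar R},
    [/\ 0 <= p.1, p.2 (~` pos) = 0%E,
      (forall B, measurable B -> B `<=` pos -> inner_approx p.2 B),
      (p.1%:E + p.2 pos <= (H 0)%:E)%E &
      forall x, 0 < x ->
        (p.1%:E + \int[p.2]_(u in pos) (1 - expR (- (x * u)))%:E = (H 0 - H x)%:E)%E].
Proof.
move=> hH Hni; have [q uq qE] := bernstein_quantile hH Hni.
have M0 : 0 <= H 0 := hankel_psd_ge0 hH (lexx 0).
exists (quantile_atom q (H 0), quantile_measure uq M0); split => /=.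
- exact: quantile_atom_ge0.
- exact: quantile_measure_compl.
- exact: quantile_measure_inner.
- exact: quantile_measure_mass.
- by move=> x x0; rewrite quantile_measure_integral // qE.
Qed.

Lemma inner_approx_sup (nu : {measure set (measurableTypeR R) -> \bar R})
    (B : set (measurableTypeR R)) : measurable B -> inner_approx nu B ->
  nu B = ereal_sup [set nu K | K in [set K : set R | compact K /\ K `<=` B]].
Proof.
move=> mB iB; apply/eqP; rewrite eq_le; apply/andP; split.
  apply/lee_addgt0Pr => e e0; have [K [cK KB nuK]] := iB e e0.
  apply: (le_trans nuK); rewrite leeD2r //; apply: ereal_sup_ubound.
  by exists K.
apply: ge_ereal_sup => _ [K [cK KB] <-]; apply: le_measure => //; rewrite inE //.
by apply: closed_measurable; apply: compact_closed => //; exact: Rhausdorff.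
Qed.

Lemma compact_pos_bound (K : set R) : compact K -> K `<=` pos ->
  exists2 a : R, 0 < a & K `<=` `[a, +oo[.
Proof.
move=> cK Kp; have oK : open (~` K).
  by apply: closed_openC; apply: compact_closed => //; exact: Rhausdorff.
have K0 : (~` K) 0 by move=> /Kp; rewrite /= in_itv /= ltxx.
have /nbhs_ballP [a /= a0 aK] := open_nbhs_nbhs (conj oK K0).
exists a => // x Kx; rewrite /= in_itv /= andbT leNgt; apply/negP => xa.
apply: (aK x) => //; rewrite /ball /= sub0r normrN gtr0_norm //.
by have := Kp _ Kx; rewrite /= in_itv /= andbT.
Qed.

(** Finitely many terms are handled together on a union of compact sets, and the series is the limit
    of its partial sums. *)
Lemma inner_approx_series (nu_ : nat -> {measure set (measurableTypeR R) -> \bar R})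
    (B : set (measurableTypeR R)) : measurable B -> (forall n, inner_approx (nu_ n) B) ->
  mseries nu_ 0 B = ereal_sup [set mseries nu_ 0 K | K in [set K : set R | compact K /\ K `<=` B]].
Proof.
move=> mB iB; have mcK K : compact K -> measurable (K : set R).
  by move=> cK; apply: closed_measurable; apply: compact_closed => //; exact: Rhausdorff.
have fin N : forall e, 0 < e -> exists K : set R, [/\ compact K, K `<=` B &
    (\sum_(k < N) nu_ k B <= \sum_(k < N) nu_ k K + e%:E)%E].
  elim: N => [|N IHN] e e0.
    by exists set0; split; [exact: compact0|exact: sub0set|rewrite !big_ord0 add0e lee_fin ltW].
  have e2 : 0 < e / 2 by exact: divr_gt0.
  have [K1 [c1 K1B h1]] := IHN _ e2; have [K2 [c2 K2B h2]] := iB N _ e2.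
  exists (K1 `|` K2); split; [exact: compactU|by move=> x []; [exact: K1B|exact: K2B]|].
  rewrite !big_ord_recr /=; apply: (le_trans (leeD h1 h2)).
  rewrite addeACA -EFinD -splitr leeD2r //; apply: leeD.
    apply: lee_sum => k _; apply: le_measure; rewrite ?inE //; first exact: mcK.
    by apply: measurableU; exact: mcK.
  apply: le_measure; rewrite ?inE //; first exact: mcK.
  by apply: measurableU; exact: mcK.
apply/eqP; rewrite eq_le; apply/andP; split; last first.
  apply: ge_ereal_sup => _ [K [cK KB] <-].
  by apply: (@le_measure _ _ _ (mseries nu_ 0)) => //; rewrite inE //; exact: mcK.
apply: lime_le; first by apply: is_cvg_nneseries => n _ _; exact: measure_ge0.
apply: nearW => N; rewrite big_mkord; apply/lee_addgt0Pr => e e0.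
have [K [cK KB h]] := fin N e e0; apply: (le_trans h); rewrite leeD2r //.
apply: (@le_trans _ _ (mseries nu_ 0 K)); last by apply: ereal_sup_ubound; exists K.
by rewrite /mseries -(big_mkord predT (fun k => nu_ k K)); apply: nneseries_lim_ge => n _ _; exact: measure_ge0.
Qed.

Lemma integral_powR_expR (nu : {measure set (measurableTypeR R) -> \bar R}) (t : R) : 0 < t ->
  (\int[nu]_(s in `]0%R, +oo[) (1 - t `^ (- s))%:E =
   \int[nu]_(u in pos) (1 - expR (- (ln t * u)))%:E)%E.
Proof.
move=> t0; apply: eq_integral => u _.
by rewrite /powR gt_eqF // mulNr mulrC.
Qed.

Section Necessity.
Variable f : R -> R.
Hypothesis hf : forall t, 1 <= t -> 1 <= f t.
Hypothesis pf : LG_preserver f.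

Lemma preserver1 : f 1 = 1.
Proof.
pose M : 'M[R]_1 := const_mx 1.
have lM : Lorentz_Gram M.
  apply: (@Lorentz_Gram_hyperplane R 1 M (fun=> 1) ord0) => [i j|i j|i|c]; rewrite ?mxE //.
  by rewrite big_ord_recl big_ord0 addr0 mulr1 => c0; rewrite /qform big_ord_recl big_ord0 c0 big1 ?addr0 // => i _; rewrite !mul0r.
by have [_ _ _ /(_ ord0) + _] := pf lM; rewrite !mxE.
Qed.

Definition Bernstein_representation (alpha beta gamma : R)
    (nu : {measure set (measurableTypeR R) -> \bar R}) : Prop :=
  [/\ 0 <= alpha <= 1, 0 <= beta, 0 <= gamma & Radon_on `]0, +oo[%classic nu] /\
  [/\ forall t : R, 1 <= t ->
        ((f t)%:E =
          (1 + gamma * \1_(`]1, +oo[%classic) t + beta * box_cox alpha t)%:E +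
          \int[nu]_(s in `]0%R, +oo[) (1 - t `^ (- s))%:E)%E,
      0 < alpha ->
        (alpha%:E * ((1 + gamma)%:E + nu `]0%R, +oo[%classic) <= beta%:E)%E
    & alpha = 0 ->
        (\int[nu]_(s in `]0%R, +oo[) (Num.min s 1)%:E < +oo)%E].

Lemma representation1 (alpha beta gamma t : R)
    (nu : {measure set (measurableTypeR R) -> \bar R}) : t = 1 ->
  ((f t)%:E = (1 + gamma * \1_(`]1, +oo[%classic) t + beta * box_cox alpha t)%:E +
          \int[nu]_(s in `]0%R, +oo[) (1 - t `^ (- s))%:E)%E.
Proof.
move=> ->; rewrite integral0_eq => [|s _]; last by rewrite powR1 subrr.
rewrite adde0 preserver1 indicE memNset; last by rewrite /= in_itv /= ltxx.
rewrite mulr0 addr0 /box_cox powR1 ln1 subrr mul0r.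
by case: eqP => _; rewrite mulr0 addr0.
Qed.

Lemma representation_of_limit (alpha beta gamma : R)
    (nu : {measure set (measurableTypeR R) -> \bar R}) :
    (forall x, 0 < x -> (gamma%:E + \int[nu]_(u in pos) (1 - expR (- (x * u)))%:E =
      (f (expR x) - 1 - beta * box_cox alpha (expR x))%:E)%E) ->
  forall t : R, 1 <= t -> ((f t)%:E =
          (1 + gamma * \1_(`]1, +oo[%classic) t + beta * box_cox alpha t)%:E +
          \int[nu]_(s in `]0%R, +oo[) (1 - t `^ (- s))%:E)%E.
Proof.
move=> h t; rewrite le_eqVlt => /orP[/eqP t1|t1]; first exact: representation1.
have t0 : 0 < t by exact: lt_trans t1.
have := h (ln t) (ln_gt0 t1); rewrite lnK // integral_powR_expR // => e.
rewrite indicE mem_set /=; last by rewrite in_itv /= andbT.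
rewrite mulr1 addrAC EFinD -addeA e -EFinD; congr (_%:E); ring.
Qed.

(** With [beta = alpha * C], the bound of [gamma + nu pos] by the value [C - 1] of the Hankel
    function at [0] is exactly the inequality required of [beta]. *)
Lemma positive_representation (alpha : R) : 0 < alpha -> alpha <= 1 ->
    (forall lam, 1 <= lam -> f (lam * expR n%:R) / f (expR n%:R) @[n --> \oo] --> lam `^ alpha) ->
    (forall lam t, 1 <= lam -> 1 <= t -> lam `^ alpha * f t <= f (lam * t)) ->
  exists beta gamma nu, Bernstein_representation alpha beta gamma nu.
Proof.
move=> a0 a1 ra rl.
have [C C1 [hE Eni]] := preserver_positive_exponent hf pf ra rl a0.
have [[gamma nu] /= [g0 nuc nui num nuE]] := bernstein_measure hE Eni.
have C0 : 0 <= C by exact: le_trans C1.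
have finp : (nu pos < +oo)%E.
  apply: (@le_lt_trans _ _ (gamma%:E + nu pos)%E); first by rewrite leeDr // lee_fin.
  by apply: le_lt_trans num _; rewrite ltry.
exists (alpha * C), gamma, nu; split; split => //.
- by rewrite (ltW a0).
- by rewrite mulr_ge0 // ltW.
- split => // [K cK Kp|B mB Bp].
    apply: le_lt_trans finp; apply: le_measure; rewrite ?inE //.
    by apply: closed_measurable; apply: compact_closed => //; exact: Rhausdorff.
  by apply: inner_approx_sup => //; exact: nui.
- apply: representation_of_limit => x x0; rewrite nuE //; congr (_%:E).
  rewrite mulr0 expR0 preserver1 mulr1 /box_cox gt_eqF // -expRM.
  by rewrite [x * alpha]mulrC; field; rewrite gt_eqF.
- move=> _; rewrite EFinM lee_pmul2l ?fin_numE // ?lte_fin //.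
  move: num; rewrite mulr0 expR0 preserver1 mulr1 EFinB => num.
  rewrite EFinD -addeA; apply: (le_trans (leeD2l 1%E num)).
  by rewrite -EFinB -EFinD lee_fin addrC subrK.
- by move=> az; move: a0; rewrite az ltxx.
Qed.

Lemma zero_representation :
    (forall lam, 1 <= lam -> f (lam * expR n%:R) / f (expR n%:R) @[n --> \oo] --> lam `^ 0) ->
  exists beta gamma nu, Bernstein_representation 0 beta gamma nu.
Proof.
move=> ra; have [beta b0 [bcvg bni]] := preserver_zero_exponent hf pf ra erefl.
pose H (n : nat) (x : R) := f (expR (n%:R + 1 + x)) - f (expR (n%:R + x)).
have ex n := bernstein_measure (preserver_diff_hankel pf (ler0n R n))
  (fun x y => bni n%:R x y (ler0n R n)).
have [p pP] := choice ex.
pose nu_ n := (p n).2; pose g_ n := (p n).1.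
have g0 n : (0 <= (g_ n)%:E)%E by rewrite lee_fin; have [] := pP n.
have I0 n x : 0 < x -> (0 <= \int[nu_ n]_(u in pos) (1 - expR (- (x * u)))%:E)%E.
  move=> x0; apply: integral_ge0 => u; rewrite /= in_itv /= andbT => u0.
  by rewrite lee_fin subr_ge0 expR_le1 oppr_le0 mulr_ge0 // ltW.
pose nu : {measure set (measurableTypeR R) -> \bar R} := mseries nu_ 0.
have sumE x : 0 < x -> (\sum_(n <oo) (g_ n)%:E + \int[nu]_(u in pos) (1 - expR (- (x * u)))%:E =
    (f (expR x) - 1 - beta * x)%:E)%E.
  move=> x0; rewrite ge0_integral_measure_series //; last 2 first.
  - move=> u; rewrite /= in_itv /= andbT => u0.
    by rewrite lee_fin subr_ge0 expR_le1 oppr_le0 mulr_ge0 // ltW.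
  - apply/measurable_EFinP; apply: nondecreasing_measurable => // u v uv.
    by rewrite lerD2l lerN2 ler_expR lerN2 ler_pM2l.
  rewrite -nneseriesD; [|by move=> *; exact: g0|by move=> *; exact: I0].
  apply: cvg_lim => //.
  (* Telescoping leaves the increment of [f] between [expR n%:R] and [expR (n%:R + x)], which tends
     to [beta * x]. *)
  rewrite (_ : (fun n => _) = (fun n => (f (expR x) - 1 - (f (expR (n%:R + x)) - f (expR n%:R)))%:E)).
    apply: cvg_EFin; first exact: nearW.
    by apply: cvgB; [exact: cvg_cst|apply: bcvg; exact: ltW].
  apply/funext => n; rewrite big_mkord.
  rewrite (eq_bigr (fun k : 'I_n => (H k 0 - H k x)%:E)); last by move=> k _; have [_ _ _ _ ->] := pP k.
  rewrite sumEFin; congr (_%:E); elim: n => [|n IHn].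
    by rewrite big_ord0 add0r expR0 preserver1; ring.
  rewrite big_ord_recr /= IHn /H !addr0 -natr1; ring.
have gfin : (\sum_(n <oo) (g_ n)%:E < +oo)%E.
  apply: (@le_lt_trans _ _ (f (expR 1) - 1 - beta * 1)%:E); last exact: ltry.
  rewrite -sumE // leeDl // integral_ge0 // => u; rewrite /= in_itv /= andbT => u0.
  by rewrite lee_fin subr_ge0 expR_le1 oppr_le0 mulr_ge0 // ltW.
have gs0 : (0 <= \sum_(n <oo) (g_ n)%:E)%E by apply: nneseries_ge0.
pose gamma := fine (\sum_(n <oo) (g_ n)%:E)%E.
have gE : (\sum_(n <oo) (g_ n)%:E)%E = gamma%:E by rewrite fineK // ge0_fin_numE.
have intfin : (\int[nu]_(u in pos) (1 - expR (- (1 * u)))%:E < +oo)%E.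
  apply: (@le_lt_trans _ _ (f (expR 1) - 1 - beta * 1)%:E); last exact: ltry.
  by rewrite -sumE // leeDr.
have mE (D : set (measurableTypeR R)) : measurable D ->
    measurable_fun D (fun u : measurableTypeR R => (1 - expR (- (1 * u)))%:E).
  move=> mD; apply/measurable_EFinP; apply: nondecreasing_measurable => // u v uv.
  by rewrite lerD2l lerN2 ler_expR lerN2 ler_pM2l.
have mpos : measurable pos by exact: measurable_itv.
exists beta, gamma, nu; split; split => //.
- by rewrite lexx ler01.
- by rewrite fine_ge0.
- split.
  + by rewrite /nu /= /mseries eseries0 // => n _ _; have [] := pP n.
  + move=> K cK Kp; have [a a0 Ka] := compact_pos_bound cK Kp.
    (* On [[a, +oo[] the integrand at [x = 1] is at least this constant, so the finite integral
       bounds the measure of [K]. *)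
    have e0 : 0 < 1 - expR (- a) by rewrite subr_gt0 expR_lt1 oppr_lt0.
    have ma : measurable (`[a, +oo[%classic : set (measurableTypeR R)) by exact: measurable_itv.
    have mK : measurable (K : set (measurableTypeR R)).
      by apply: closed_measurable; apply: compact_closed => //; exact: Rhausdorff.
    apply: (@le_lt_trans _ _ (nu `[a, +oo[%classic)); first by apply: le_measure; rewrite ?inE.
    rewrite -(@lte_pmul2l _ (1 - expR (- a))%:E) ?fin_numE // ?lte_fin //.
    rewrite gt0_muley ?lte_fin //; apply: le_lt_trans intfin.
    rewrite -integral_cst //; apply: (@le_trans _ _
        (\int[nu]_(u in `[a, +oo[) (1 - expR (- (1 * u)))%:E)%E).
      apply: ge0_le_integral => //.
      - by move=> u _; rewrite lee_fin ltW.
      - exact: mE.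
      - by move=> u; rewrite /= in_itv /= andbT => au; rewrite lee_fin lerD2l lerN2 ler_expR lerN2 mul1r.
    apply: ge0_subset_integral => //.
    - exact: mE.
    - by move=> u; rewrite /= in_itv /= andbT => u0; rewrite lee_fin subr_ge0 expR_le1 oppr_le0 mul1r ltW.
    - by move=> u; rewrite /= !in_itv /= !andbT; exact: lt_le_trans.
  + move=> B mB Bp; apply: inner_approx_series => // n.
    by have [_ _ + _ _] := pP n; exact.
- apply: representation_of_limit => x x0.
  by rewrite -gE sumE // /box_cox eqxx expRK.
- by rewrite ltxx.
(* [Num.min u 1] is at most [2 * (1 - expR (- u))], because [expR (- u)] is at most
   [1 / (1 + u)]. *)
- move=> _; apply: (@le_lt_trans _ _ (\int[nu]_(u in pos) (2%:E * (1 - expR (- (1 * u)))%:E))%E).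
    apply: ge0_le_integral => //.
    + by move=> u; rewrite /= in_itv /= andbT => u0; rewrite lee_fin le_min ler01 ltW.
    + apply/measurable_EFinP; apply: nondecreasing_measurable => // u v uv.
      by rewrite le_min2.
    + by apply: emeasurable_funM => //; exact: mE.
    move=> u; rewrite /= in_itv /= andbT => u0; rewrite -EFinM lee_fin mul1r expRN.
    have u1 : 0 < 1 + u by rewrite addr_gt0.
    have h : (expR u)^-1 <= (1 + u)^-1 by rewrite lef_pV2 ?posrE ?expR_gt0 // expR_ge1Dx.
    apply: (@le_trans _ _ (2 * (1 - (1 + u)^-1))); last by rewrite ler_pM2l // lerD2l lerN2.
    have -> : 2 * (1 - (1 + u)^-1) = (2 * u) / (1 + u) by field; rewrite gt_eqF.
    rewrite ler_pdivlMr //; have [u1'|u1'] := leP u 1.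
      by nra.
    by nra.
  rewrite ge0_integralZl_EFin //; first by rewrite lte_mul_pinfty // fin_numE.
    by move=> u; rewrite /= in_itv /= andbT => u0; rewrite lee_fin subr_ge0 expR_le1 oppr_le0 mul1r ltW.
  exact: mE.
Qed.

Theorem preserver_representation :
  exists alpha beta gamma nu, Bernstein_representation alpha beta gamma nu.
Proof.
have [alpha a0 [ra rl]] := preserver_exponent hf pf.
have a1 := exponent_le1 hf pf rl.
exists alpha; move: a0; rewrite le_eqVlt => /orP[/eqP az|a0].
  by move: ra; rewrite -az; exact: zero_representation.
exact: positive_representation.
Qed.

End Necessity.
End Representation.

(** * Powers of kernels *)

Section PowerKernels.
Variable R : realType.

Lemma is_derive_sumr (I : Type) (r : seq I) (h : I -> R -> R) (dh : I -> R) (x : R) :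
    (forall i, is_derive x 1 (h i) (dh i)) ->
  is_derive x 1 (fun u => \sum_(i <- r) h i u) (\sum_(i <- r) dh i).
Proof.
move=> hd; elim: r => [|i r IHr].
  rewrite big_nil; under eq_fun do rewrite big_nil; exact: is_derive_cst.
rewrite big_cons; under eq_fun do rewrite big_cons.
exact: (is_deriveD (hd i) IHr).
Qed.

(** For fixed coefficients the form vanishes at [u = 0] and has a nonnegative derivative; the mean
    value theorem gives its sign at [1]. *)
Lemma psd_of_derive (T : finType) (phi dphi : R -> T -> T -> R) :
    (forall i j, phi 0 i j = 0) ->
    (forall (u : R) i j, 0 <= u <= 1 -> is_derive u 1 (fun u => phi u i j) (dphi u i j)) ->
    (forall u : R, 0 <= u <= 1 -> psd (dphi u)) ->
  psd (phi 1).
Proof.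
move=> p0 pd pp c; pose F u := qform (phi u) c.
have F0 : F 0 = 0 by rewrite /F /qform big1 // => i _; rewrite big1 // => j _; rewrite p0 mulr0.
have dF (u : R) : 0 <= u <= 1 -> is_derive u 1 F (qform (dphi u) c).
  move=> u01; apply: is_derive_sumr => i; apply: is_derive_sumr => j.
  exact: (@is_deriveZ R R R (fun u => phi u i j) (c i * c j) u 1 (dphi u i j) (pd _ _ _ u01)).
have Fc : {within `[0, 1], continuous F}.
  apply: derivable_within_continuous => u; rewrite in_itv /= => u01.
  exact: (@ex_derive _ _ _ _ _ _ _ (dF u u01)).
have Fd (u : R) : u \in `]0, 1[ -> is_derive u 1 F (qform (dphi u) c).
  by rewrite in_itv /= => /andP[? ?]; apply: dF; rewrite !ltW.
have [t t01] := MVT ltr01 Fd Fc.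
rewrite F0 !subr0 mulr1 -/(F 1) => ->; apply: pp.
by move: t01; rewrite in_itv /= => /andP[? ?]; rewrite !ltW.
Qed.

Lemma psd_sum (T : finType) (K : nat -> T -> T -> R) (a : nat -> R) n :
    (forall k, 0 <= a k) -> (forall k, psd (K k)) ->
  psd (fun i j => \sum_(0 <= k < n) a k * K k i j).
Proof.
move=> a0 pK; elim: n => [|n IHn].
  by apply: (@eq_psd _ _ (fun _ _ => 0)) => [i j|]; [rewrite big_nil|exact: psd_cst].
apply: eq_psd (psdD IHn (psdZ (a0 n) (pK n))) => i j.
by rewrite big_nat_recr.
Qed.

Section GeometricKernel.
Variables (T : finType) (k : T -> T -> R).
Hypotheses (sk : forall i j, k i j = k j i) (pk : psd k) (k1 : forall i j, `|k i j| < 1).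

Lemma psd_geometric : psd (fun i j => (1 - k i j)^-1).
Proof.
apply: (@psd_cvg _ _ (fun n i j => \sum_(0 <= l < n) 1 * k i j ^+ l)).
  by move=> n; apply: psd_sum => // l; exact: psdX.
by move=> i j; have := @cvg_geometric_series R 1 (k i j) (k1 i j); rewrite div1r; exact.
Qed.

End GeometricKernel.

Lemma psd_exp (T : finType) (K : T -> T -> R) : (forall i j, K i j = K j i) -> psd K ->
  psd (fun i j => expR (K i j)).
Proof.
move=> sK pK.
apply: (@psd_cvg _ _ (fun n i j => \sum_(0 <= l < n) (l`!%:R)^-1 * K i j ^+ l)).
  by move=> n; apply: psd_sum => l; [rewrite invr_ge0|exact: psdX].
move=> i j; have := is_cvg_series_exp_coeff (K i j).
rewrite /expR exp_coeffE; exact.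
Qed.

Section LogKernel.
Variables (T : finType) (k : T -> T -> R).
Hypotheses (sk : forall i j, k i j = k j i) (pk : psd k) (k1 : forall i j, `|k i j| < 1).

Let uk1 (u : R) i j : 0 <= u <= 1 -> `|u * k i j| < 1.
Proof.
move=> /andP[u0 u1]; rewrite normrM (ger0_norm u0); apply: le_lt_trans (k1 i j).
by rewrite ler_piMl.
Qed.

Let w0 (u : R) i j : 0 <= u <= 1 -> 0 < 1 - u * k i j.
Proof. by move=> u01; have := @uk1 u i j u01; rewrite ltr_norml subr_gt0 => /andP[]. Qed.

Lemma is_derive_ln_one_sub (u : R) i j : 0 <= u <= 1 ->
  is_derive u 1 (fun u => ln (1 - u * k i j)) (- (k i j / (1 - u * k i j))).
Proof.
move=> u01; have h := is_derive1_ln (w0 i j u01).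
have h2 : is_derive u 1 (fun u => 1 - u * k i j) (- k i j).
  have h3 : is_derive u 1 (fun u : R => u * k i j) (k i j).
    have := @is_deriveZ R R R id (k i j) u 1 1 (is_derive_id _ _).
    rewrite (_ : k i j \*: id = fun u => u * k i j); last by apply/funext => v; rewrite /= mulrC.
    by rewrite [k i j *: _]mulr1.
  have := is_deriveB (is_derive_cst (1 : R) u 1) h3; rewrite sub0r; exact.
have := @is_derive1_comp R (@ln R) (fun u => 1 - u * k i j) u _ _ h h2.
by rewrite mulrN mulrC.
Qed.

(** The derivative of [- ln (1 - u * k)] in [u] is [k] times a geometric kernel. *)
Lemma psd_Nln : psd (fun i j => - ln (1 - k i j)).
Proof.
have := @psd_of_derive T (fun u i j => - ln (1 - u * k i j)) (fun u i j => k i j / (1 - u * k i j)).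
move=> h; apply: (@eq_psd _ _ (fun i j => - ln (1 - 1 * k i j))); first by move=> i j; rewrite mul1r.
apply: h => [i j|u i j u01|u u01].
- by rewrite mul0r subr0 ln1 oppr0.
- by have := is_deriveN (is_derive_ln_one_sub i j u01); rewrite opprK; exact.
apply: psdM => //; apply: (psd_geometric (k := fun i j => u * k i j)) => [i j||i j]; first by rewrite sk.
  by apply: psdZ => //; case/andP: u01.
exact: uk1.
Qed.

Lemma psd_pow_neg s : 0 <= s -> psd (fun i j => expR (- s * ln (1 - k i j))).
Proof.
move=> s0; apply: (@eq_psd _ _ (fun i j => expR (s * - ln (1 - k i j)))).
  by move=> i j; rewrite mulrN mulNr.
by apply: psd_exp => [i j|]; [rewrite sk|apply: psdZ => //; exact: psd_Nln].
Qed.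

End LogKernel.

(** The derivative in [u] is [a * k] times [1 - u * k] to the power [- (1 - a)], which [psd_pow_neg]
    covers as [a] is at most [1]. *)
Lemma psd_one_sub_pow (T : finType) (k : T -> T -> R) a :
    (forall i j, k i j = k j i) -> psd k -> (forall i j, `|k i j| < 1) -> 0 <= a <= 1 ->
  psd (fun i j => 1 - expR (a * ln (1 - k i j))).
Proof.
move=> sk pk k1 /andP[a0 a1].
have uk1 (u : R) i j : 0 <= u <= 1 -> `|u * k i j| < 1.
  move=> /andP[u0 u1]; rewrite normrM (ger0_norm u0); apply: le_lt_trans (k1 i j).
  by rewrite ler_piMl.
have w0 (u : R) i j : 0 <= u <= 1 -> 0 < 1 - u * k i j.
  by move=> u01; have := uk1 u i j u01; rewrite ltr_norml subr_gt0 => /andP[].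
pose dphi u i j := a * (k i j * expR (- (1 - a) * ln (1 - u * k i j))).
have := @psd_of_derive T (fun u i j => 1 - expR (a * ln (1 - u * k i j))) dphi.
move=> h; apply: (@eq_psd _ _ (fun i j => 1 - expR (a * ln (1 - 1 * k i j)))).
  by move=> i j; rewrite mul1r.
apply: h => [i j|u i j u01|u u01].
- by rewrite mul0r subr0 ln1 mulr0 expR0 subrr.
- have d1 := @is_deriveZ R R R _ a u 1 _ (is_derive_ln_one_sub k1 i j u01).
  have d2 := @is_derive1_comp R (@expR R) _ u _ _ (is_derive_expR _) d1.
  have := is_deriveB (is_derive_cst (1 : R) u 1) d2; rewrite sub0r.
  suff -> : dphi u i j = - (expR (a * ln (1 - u * k i j)) * (a * - (k i j / (1 - u * k i j)))) by exact.
  rewrite /dphi mulNr mulrBl mul1r opprB expRB lnK ?posrE ?w0 //.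
  ring.
apply: psdZ => //; apply: psdM => //.
apply: (psd_pow_neg (k := fun i j => u * k i j)) => [i j||i j|]; rewrite ?subr_ge0 //; first by rewrite sk.
  by apply: psdZ => //; case/andP: u01.
exact: uk1.
Qed.

End PowerKernels.

(** * Sufficiency of the representation *)

Section Sufficiency.
Variable R : realType.
Notation pos := (`]0, +oo[%classic : set (measurableTypeR R)).

(** Turns a quadratic form of integrals into the integral of quadratic forms. *)
Lemma integral_lincomb (nu : {measure set (measurableTypeR R) -> \bar R}) (J : Type)
    (r : seq J) (a : J -> R) (g : J -> R -> R) (I : J -> R) :
    (forall j u, pos u -> 0 <= g j u) ->
    (forall j, measurable_fun pos (g j : measurableTypeR R -> R)) ->
    (forall j, \int[nu]_(u in pos) (g j u)%:E = (I j)%:E)%E ->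
  nu.-integrable pos (fun u : measurableTypeR R => (\sum_(j <- r) a j * g j u)%:E) /\
  (\int[nu]_(u in pos) (\sum_(j <- r) a j * g j u)%:E = (\sum_(j <- r) a j * I j)%:E)%E.
Proof.
move=> g0 mg gI; have mpos : measurable pos by exact: measurable_itv.
have ig j : nu.-integrable pos (fun u : measurableTypeR R => (g j u)%:E).
  apply/integrableP; split; first by apply/measurable_EFinP; exact: mg.
  apply: le_lt_trans (ltry (I j)); rewrite -gI le_eqVlt; apply/orP; left.
  by apply/eqP/eq_integral => u; rewrite inE => pu; rewrite gee0_abs // lee_fin; exact: g0.
have iag j : nu.-integrable pos (fun u : measurableTypeR R => (a j)%:E * (g j u)%:E)%E.
  exact: integrableZl.
suff S (h : measurableTypeR R -> R) : (forall u, h u = \sum_(j <- r) a j * g j u) ->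
    nu.-integrable pos (fun u => (h u)%:E) /\
    (\int[nu]_(u in pos) (h u)%:E = (\sum_(j <- r) a j * I j)%:E)%E by exact: S.
elim: r h => [|j r IHr] h hE.
  have -> : (fun u => (h u)%:E) = cst 0%E by apply/funext => u; rewrite hE big_nil.
  by rewrite big_nil integral0; split => //; exact: integrable0.
have [IHi IHe] := IHr (fun u => \sum_(j <- r) a j * g j u) (fun=> erefl).
have -> : (fun u => (h u)%:E) =
    (fun u => (a j)%:E * (g j u)%:E + (\sum_(j <- r) a j * g j u)%:E)%E.
  by apply/funext => u; rewrite hE big_cons EFinD EFinM.
split; first exact: integrableD.
by rewrite integralD // IHe integralZl // gI big_cons -EFinM -EFinD.
Qed.

Section Matrix.
Variables (T : finType) (b : T -> R) (m : T -> T -> R).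
Hypotheses (b0 : forall i, 0 < b i) (sm : forall i j, m i j = m j i)
  (m1 : forall i j, 1 <= m i j) (pm : psd (fun i j => b i * b j - m i j)).

Let k i j := 1 - m i j / (b i * b j).

Let sk i j : k i j = k j i.
Proof. by rewrite /k sm [b j * _]mulrC. Qed.

Let pk : psd k.
Proof.
apply: (eq_psd _ (psd_scale (fun i => (b i)^-1) pm)) => i j.
by rewrite /k; field; rewrite !gt_eqF.
Qed.

Let bb i j : 0 < b i * b j. Proof. exact: mulr_gt0. Qed.

Let m0 i j : 0 < m i j. Proof. exact: lt_le_trans (m1 i j). Qed.

Let k_lt1 i j : k i j < 1.
Proof. by rewrite /k gtrBl divr_gt0. Qed.

(** Diagonal entries lie in [[0, 1[]; off the diagonal, the coefficients [1], [1] bound [k i j]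
    below by minus the mean of two diagonal entries. *)
Let k1 i j : `|k i j| < 1.
Proof.
rewrite ltr_norml k_lt1 andbT.
have [ij|ij] := eqVneq i j.
  rewrite ij; have : 0 <= k j j; last by lra.
  have := pk (fun t => (t == j)%:R); rewrite /qform (bigD1 j) //= [X in _ + X]big1 ?addr0.
    by rewrite (bigD1 j) //= big1 ?addr0 ?eqxx ?mul1r // => t /negbTE ->; rewrite mulr0 mul0r.
  by move=> t /negbTE ->; rewrite big1 // => ? _; rewrite !mul0r.
have := psd_sub (fun s : bool => if s then i else j) pk (fun=> 1).
rewrite /qform !big_bool /= !mul1r (sk j i); have := k_lt1 i i; have := k_lt1 j j; lra.
Qed.

Let one_sub_k i j : 1 - k i j = m i j / (b i * b j).
Proof. by rewrite /k; ring. Qed.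

Let lnm i j : ln (1 - k i j) = ln (m i j) - (ln (b i) + ln (b j)).
Proof. by rewrite one_sub_k ln_div ?posrE // lnM ?posrE. Qed.

Lemma psd_powR_neg s : 0 <= s -> psd (fun i j => m i j `^ (- s)).
Proof.
move=> s0; apply: (eq_psd _ (psd_scale (fun i => expR (- s * ln (b i))) (psd_pow_neg sk pk k1 s0))).
by move=> i j; rewrite lnm -!expRD /powR gt_eqF //; congr expR; ring.
Qed.

Lemma psd_powR_sub a : 0 <= a <= 1 -> psd (fun i j => b i `^ a * b j `^ a - m i j `^ a).
Proof.
move=> a01; apply: (eq_psd _ (psd_scale (fun i => b i `^ a) (psd_one_sub_pow sk pk k1 a01))).
move=> i j; rewrite mulrBr mulr1; congr (_ - _).
by rewrite lnm /powR !gt_eqF // -!expRD; congr expR; ring.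
Qed.

(** [ln (m i j)] is [ln (1 - k i j)] plus functions of one index each, which the condition on [c]
    annihilates. *)
Lemma qform_ln_le0 c : \sum_i c i = 0 -> qform (fun i j => ln (m i j)) c <= 0.
Proof.
move=> c0; have := psd_Nln sk pk k1 c.
rewrite (eq_qform (L := fun i j => (ln (b i) + ln (b j)) - ln (m i j))); last first.
  by move=> i j; rewrite lnm opprB.
rewrite qformB (_ : qform _ _ = 0) ?sub0r ?oppr_ge0 // qformD.
have h : qform (fun i j => ln (b i)) c = 0.
  rewrite /qform big1 // => i _; rewrite (eq_bigr (fun j => c i * ln (b i) * c j)).
    by rewrite -mulr_sumr c0 mulr0.
  by move=> j _; ring.
rewrite h add0r /qform exchange_big; apply: etrans h; apply: eq_bigr => i _.
by apply: eq_bigr => j _; ring.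
Qed.

(** A limit of entrywise powers of [1 / m], whose entries are at most [1]; it accounts for the jump
    of [f]. *)
Lemma psd_eq1 : psd (fun i j => (m i j == 1)%:R : R).
Proof.
have pV : psd (fun i j => (m i j)^-1).
  by apply: eq_psd (psd_powR_neg ler01) => i j; rewrite powR_inv1 // ltW.
apply: (@psd_cvg _ _ (fun n i j => (m i j)^-1 ^+ n)).
  by move=> n; apply: psdX => // i j; rewrite sm.
move=> i j; have := m1 i j; rewrite le_eqVlt => /orP[/eqP <-|m1'].
  by rewrite eqxx invr1; under eq_fun do rewrite expr1n; exact: cvg_cst.
rewrite gt_eqF //; apply: cvg_expr.
by rewrite ger0_norm ?invr_ge0 ?(ltW (m0 i j)) // invf_lt1.
Qed.

Variables (nu : {measure set (measurableTypeR R) -> \bar R}) (I : T -> T -> R).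
Hypothesis mI : forall i j, (\int[nu]_(s in pos) (1 - m i j `^ (- s))%:E = (I i j)%:E)%E.

Let g (p : T * T) (s : R) : R := 1 - m p.1 p.2 `^ (- s).

Let g0 p s : pos s -> 0 <= g p s.
Proof.
rewrite /= in_itv /= andbT => s0; rewrite subr_ge0 powRN invf_le1 ?powR_gt0 //.
by rewrite -(powRr0 (m p.1 p.2)) ler_powR // ltW.
Qed.

Let mg p : measurable_fun pos (g p : measurableTypeR R -> R).
Proof.
apply: nondecreasing_measurable => // u v uv.
by rewrite lerD2l lerN2 ler_powR // lerN2.
Qed.

Lemma qform_pair (K : T -> T -> R) c : qform K c = \sum_p c p.1 * c p.2 * K p.1 p.2.
Proof. by rewrite /qform (pair_bigA _ (fun i j => c i * c j * K i j)). Qed.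

Lemma qform_integral_le0 c : \sum_i c i = 0 -> qform I c <= 0.
Proof.
move=> c0; have [_ e] := @integral_lincomb nu _ (index_enum (T * T)%type)
  (fun p => - (c p.1 * c p.2)) g (fun p => I p.1 p.2) g0 mg (fun p => mI p.1 p.2).
have -> : qform I c = - \sum_p - (c p.1 * c p.2) * I p.1 p.2.
  by rewrite qform_pair -sumrN; apply: eq_bigr => p _; rewrite mulNr opprK.
rewrite oppr_le0 -lee_fin -e; apply: integral_ge0 => s; rewrite /= in_itv /= andbT => s0.
rewrite lee_fin (_ : \sum_(_ <- _) _ = qform (fun i j => m i j `^ (- s)) c).
  by apply: psd_powR_neg; exact: ltW.
transitivity (- qform (fun i j => 1 - m i j `^ (- s)) c).
  by rewrite qform_pair -sumrN; apply: eq_bigr => p _; rewrite mulNr.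
by rewrite qformB (qform_cst 1) c0 expr0n mulr0 sub0r opprK.
Qed.

(** The mass [N] enters as the integral of [1] under the index [None]; the difference of the two
    sides is then the integral of the forms of [m^(- s)]. *)
Lemma qform_integral_le c N : nu pos = N%:E -> qform I c <= N * (\sum_i c i) ^+ 2.
Proof.
move=> nuN; pose a (o : option (T * T)) := if o is Some p then - (c p.1 * c p.2) else (\sum_i c i) ^+ 2.
pose g' (o : option (T * T)) (s : R) := if o is Some p then g p s else 1.
pose I' (o : option (T * T)) := if o is Some p then I p.1 p.2 else N.
have [|||_ e] := @integral_lincomb nu _ (index_enum (option (T * T))) a g' I'.
- by move=> [p|] s ps //=; exact: g0.
- by move=> [p|]; [exact: mg|exact: measurable_cst].
- move=> [p|] /=; first exact: mI.
  by rewrite (integral_cst nu (measurable_itv _ : measurable pos) 1%E) mul1e.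
rewrite -subr_ge0 (_ : _ - _ = \sum_o a o * I' o); last first.
  rewrite big_option /= [N * _]mulrC qform_pair -sumrN; congr (_ + _).
  by apply: eq_bigr => p _; rewrite mulNr.
rewrite -lee_fin -e; apply: integral_ge0 => s; rewrite /= in_itv /= andbT => s0.
rewrite lee_fin (_ : \sum_(_ <- _) _ = qform (fun i j => m i j `^ (- s)) c).
  by apply: psd_powR_neg; exact: ltW.
rewrite big_option /= mulr1.
transitivity ((\sum_i c i) ^+ 2 - qform (fun i j => 1 - m i j `^ (- s)) c).
  by rewrite qform_pair -sumrN; congr (_ + _); apply: eq_bigr => p _; rewrite mulNr.
by rewrite qformB (qform_cst 1) mul1r; ring.
Qed.

End Matrix.

Theorem representation_preserver (f : R -> R) (alpha beta gamma : R)
    (nu : {measure set (measurableTypeR R) -> \bar R}) :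
    (forall t : R, 1 <= t -> 1 <= f t) ->
  Bernstein_representation f alpha beta gamma nu -> LG_preserver f.
Proof.
move=> hf [[a01 b0 g0 _] [fE apos _]] n M lM.
have [n0 sM M1 dM _] := lM; have i0 : 'I_n := Ordinal n0.
have sM' i j : M i j = M j i by rewrite -[in LHS]sM mxE.
pose b i := M i0 i; have bp i : 0 < b i by exact: lt_le_trans (M1 i0 i).
have pM : psd (fun i j => b i * b j - M i j) := Lorentz_Gram_schur i0 lM.
pose I i j := f (M i j) - (1 + gamma * \1_(`]1, +oo[%classic) (M i j) + beta * box_cox alpha (M i j)).
have mI i j : (\int[nu]_(s in pos) (1 - M i j `^ (- s))%:E = (I i j)%:E)%E.
  by rewrite /I EFinB fE // addrAC subee // add0e.
have f1 : f 1 = 1.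
  have := fE 1 (lexx 1); rewrite integral0_eq => [|s _]; last by rewrite powR1 subrr.
  rewrite adde0 indicE memNset; last by rewrite /= in_itv /= ltxx.
  rewrite mulr0 addr0 /box_cox powR1 ln1 subrr mul0r.
  by case: eqP => _; rewrite mulr0 addr0 => -[].
have fM i j : f (M i j) = 1 + gamma - gamma * (M i j == 1)%:R + beta * box_cox alpha (M i j) + I i j.
  rewrite /I indicE; suff -> : (M i j \in `]1, +oo[%classic) = (M i j != 1).
    by case: eqP => _ /=; ring.
  by rewrite mem_setE /= in_itv /= andbT lt_def M1 andbT.
apply: (@Lorentz_Gram_hyperplane R n (map_mx f M) (fun i => b i `^ alpha) i0).
- by move=> i j; rewrite !mxE sM'.
- by move=> i j; rewrite mxE hf.
- by move=> i; rewrite mxE dM.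
move=> c cb; pose S := \sum_i c i.
rewrite (eq_qform (L := fun i j => (1 + gamma) - gamma * (M i j == 1)%:R +
    beta * box_cox alpha (M i j) + I i j)); last by move=> i j; rewrite mxE fM.
rewrite qformD qformD qformB qform_cst !qformZ -/S.
have d0 : 0 <= gamma * qform (fun i j => (M i j == 1)%:R : R) c.
  by apply: mulr_ge0 => //; exact: (psd_eq1 bp sM' M1 pM).
have [az|an] := eqVneq alpha 0.
  have S0 : S = 0.
    by rewrite -cb; apply: eq_bigr => i _; rewrite az powRr0 mulr1.
  have ln0 : qform (fun i j => box_cox alpha (M i j)) c <= 0.
    by rewrite /box_cox az eqxx; exact: (qform_ln_le0 bp sM' M1 pM).
  have I0 : qform I c <= 0 by exact: (qform_integral_le0 bp sM' M1 pM mI).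
  rewrite S0 expr0n mulr0 /=; have := mulr_ge0_le0 b0 ln0; lra.
have ap : 0 < alpha by rewrite lt_def an; case/andP: a01.
have := apos ap; have nu0 : (0 <= nu pos)%E by exact: measure_ge0.
have finN : (nu pos < +oo)%E.
  rewrite ltNge leye_eq; apply/negP => /eqP e; move: (apos ap).
  by rewrite e addey // gt0_muley ?lte_fin.
have NE : nu pos = (fine (nu pos))%:E by rewrite fineK // ge0_fin_numE.
set N := fine _ in NE; rewrite NE -EFinD -EFinM lee_fin => ineq.
have Ib : qform I c <= N * S ^+ 2 := qform_integral_le bp sM' M1 pM mI c NE.
have pw : qform (fun i j => M i j `^ alpha) c <= 0.
  have := psd_powR_sub bp sM' M1 pM a01 c.
  by rewrite qformB (qform_rank1 (fun i => b i `^ alpha)) cb expr0n sub0r oppr_ge0.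
have -> : qform (fun i j => box_cox alpha (M i j)) c =
    alpha^-1 * (qform (fun i j => M i j `^ alpha) c - S ^+ 2).
  rewrite -[S ^+ 2]mul1r -qform_cst -qformB -qformZ; apply: eq_qform => i j.
  by rewrite /box_cox (negbTE an) mulrC.
(* Collecting multiples of [S ^+ 2]: the constants and the integral give at most [1 + gamma + N],
   and the [- 1] inside [box_cox] gives [- beta / alpha]. *)
have ba : 1 + gamma + N <= beta / alpha by rewrite ler_pdivlMr // mulrC.
have h1 : beta / alpha * qform (fun i j => M i j `^ alpha) c <= 0.
  by rewrite mulr_ge0_le0 // divr_ge0 // ltW.
have h2 : (1 + gamma + N) * S ^+ 2 <= beta / alpha * S ^+ 2 by rewrite ler_wpM2r ?sqr_ge0.
rewrite mulrA mulrBr; lra.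
Qed.

End Sufficiency.

Theorem mainTheorem1 (R : realType) (f : R -> R)
    (hf : forall t : R, 1 <= t -> 1 <= f t) :
  (forall (n : nat) (M : 'M[R]_n), Lorentz_Gram M -> Lorentz_Gram (map_mx f M))
  <->
  exists (alpha beta gamma : R)
         (nu : {measure set (measurableTypeR R) -> \bar R}),
    [/\ 0 <= alpha <= 1, 0 <= beta, 0 <= gamma & Radon_on `]0, +oo[%classic nu] /\
    [/\ forall t : R, 1 <= t ->
          ((f t)%:E =
            (1 + gamma * \1_(`]1, +oo[%classic) t + beta * box_cox alpha t)%:E +
            \int[nu]_(s in `]0%R, +oo[) (1 - t `^ (- s))%:E)%E,
        0 < alpha ->
          (alpha%:E * ((1 + gamma)%:E + nu `]0%R, +oo[%classic) <= beta%:E)%E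
      & alpha = 0 ->
          (\int[nu]_(s in `]0%R, +oo[) (Num.min s 1)%:E < +oo)%E].
Proof.
split=> [pf|[alpha [beta [gamma [nu rep]]]]]; first exact: preserver_representation.
exact: representation_preserver hf rep.
Qed.
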